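(* Let $\mathcal C$ be a strict BTC over $\mathbb F$ and $\mathcal S\subset\mathcal C$ a full tensor subcategory which is a finite admissible STC, with $\mathcal S\simeq\mathrm{Rep}\,G$, $G=\mathrm{Aut}(\Gamma,m,\eta)$. Let $\mathcal S_0=\mathcal S\cap Z_2(\mathcal C)\subset\mathcal S$ and let $N$ be the normal subgroup of $G$ corresponding to the full inclusion $\mathcal S_0\subset\mathcal S$. Then $$\mathrm{Spec}\,(\mathcal C\rtimes\mathcal S)=N.$$ In particular, $\mathcal C\rtimes\mathcal S$ has full $G$-spectrum (i.e. $\mathrm{Spec}\,(\mathcal C\rtimes\mathcal S)=G$) if and only if $\mathcal S\cap Z_2(\mathcal C)$ is trivial, i.e. consists only of multiples of $\mathbf 1$.
   Context: **Categories.** $\mathbb F$ is an algebraically closed field of characteristic zero. A BTC is a semisimple $\mathbb F$-linear rigid braided ribbon category with finite dimensional $\mathrm{Hom}$-spaces and $\mathrm{End}\,\mathbf 1=\mathbb F\,\mathrm{id}_{\mathbf 1}$; it carries a canonical spherical structure with dimension function $d$. For each object $X$ with dual $\overline X$ let $\varepsilon_X:\mathbf 1\to X\otimes\overline X$ and $\overline\varepsilon_X:X\otimes\overline X\to\mathbf 1$ be the duality morphisms of the spherical structure, so that $\overline\varepsilon_X\circ(s\otimes\mathrm{id}_{\overline X})\circ\varepsilon_X=\mathrm{Tr}_X(s)$ and $\overline\varepsilon_X\circ\varepsilon_X=d(X)$. An STC is a symmetric BTC; it is finite if it has finitely many isomorphism classes of simple objects. An STC is admissible if either (i) $\mathbb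 F=\mathbb C$, the category is a $*$-category (it has a positive involutive antilinear contravariant monoidal endofunctor $*$ acting trivially on objects) and all objects have trivial twist, or (ii) $d(X)\in\mathbb Z_+$ for all $X$, the dimension being that of the symmetric category for which the twist is trivial; in both cases twists are trivial and dimensions are positive integers for nonzero objects. $Z_2(\mathcal C)$ is the full subcategory of those $X\in\mathcal C$ with $c_{X,Y}\circ c_{Y,X}=\mathrm{id}$ for all $Y\in\mathcal C$, where $c$ is the braiding of $\mathcal C$. **The Frobenius algebra.** $\mathcal C$ is a strict BTC with braiding $c$, not necessarily finite; $\mathcal S\subset\mathcal C$ is a full tensor subcategory (closed under duals, finite direct sums and subobjects) which is a finite admissible STC. By Doplicher–Roberts and Deligne there is a finite group $G$, unique up to isomorphism, with $\mathcal S\simeq\mathrm{Rep}_{\mathbb F}G$ as symmetric tensor categories. Let $(\Gamma,m,\eta,\Delta,\varepsilon)$ be the Frobenius algebra in $\mathcal S$ corresponding to the left regular representation on functions $G\to\mathbb F$, with pointwise multiplication $m$, unit $\eta$ the constant function $1$, $\Delta(\delta_g)=|G|\,\delta_g\otimes\delta_g$, $\varepsilon(\delta_g)=|G|^{-1}$. Thus $m\circ\Delta=|G|\,\mathrm{id}_\Gamma$, $\varepsilon\circ\eta=\mathrm{id}_{\mathbf 1}$, $m\circ c_{\Gamma,\Gamma}=m$, $c_{\Gamma,\Gamma}\circ\Delta=\Delta$. The group $G$ is identified with $\mathrm{Aut}(\Gamma,m,\eta)=\{g\in\mathrm{End}\,\Gamma\mid g\circ m=m\circ(g\otimes g),\ g\circ\eta=\eta\}$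 under composition. **The subgroup $N$.** For a full STC $\mathcal S_0\subset\mathcal S$ let $(\Gamma_0,\ldots)$ be the corresponding regular Frobenius algebra of $\mathcal S_0$. Then $\Gamma\cong\Gamma_0\oplus Z$ with $\mathrm{Hom}(\Gamma_0,Z)=\{0\}$; let $q\in\mathrm{End}\,\Gamma$ be the (central) idempotent projecting onto $\Gamma_0$ (the sum of the isotypic components of $\Gamma$ belonging to $\mathcal S_0$). The normal subgroup corresponding to $\mathcal S_0\subset\mathcal S$ is $N=\{g\in G\mid g\circ q=q\}$. Equivalently $N=\{g\in G\mid\pi_X(g)=\mathrm{id}_{E(X)}\ \forall X\in\mathcal S_0\}$, where $E(X)=\mathrm{Hom}(\mathbf 1,\Gamma\otimes X)$ and $\pi_X(g)\phi=(g\otimes\mathrm{id}_X)\circ\phi$. **The Galois extension.** $\mathcal C\rtimes_0\mathcal S$ is the strict tensor category with the same objects, and the same tensor product of objects, as $\mathcal C$; $\mathrm{Hom}_{\mathcal C\rtimes_0\mathcal S}(X,Y)=\mathrm{Hom}_{\mathcal C}(\Gamma\otimes X,Y)$; composition $t\,\hat\circ\, s=t\circ(\mathrm{id}_\Gamma\otimes s)\circ(\Delta\otimes\mathrm{id}_X)$ for $s\in\mathrm{Hom}_{\mathcal C}(\Gamma\otimes X,Y)$, $t\in\mathrm{Hom}_{\mathcal C}(\Gamma\otimes Y,Z)$; and $s\,\hat\otimes\, t=(s\otimes t)\circ(\mathrm{id}_\Gamma\otimes c_{\Gamma,X}\otimes\mathrm{id}_Z)\circ(\Delta\otimes\mathrm{id}_X\otimes\mathrm{id}_Z)$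 for $s\in\mathrm{Hom}_{\mathcal C}(\Gamma\otimes X,Y)$, $t\in\mathrm{Hom}_{\mathcal C}(\Gamma\otimes Z,T)$. The identity of $X$ is $\varepsilon\otimes\mathrm{id}_X$. $\mathcal C\rtimes\mathcal S$ is its idempotent completion: objects are pairs $(X,p)$ with $p=p\,\hat\circ\,p\in\mathrm{End}_{\mathcal C\rtimes_0\mathcal S}(X)$, and $(X,p)\otimes(Y,q)=(X\otimes Y,p\,\hat\otimes\,q)$. It is a semisimple strict spherical tensor category. **Grading and spectrum.** For a simple object $X_1=(X,p)$ of $\mathcal C\rtimes\mathcal S$ put $d(X_1)=\overline\varepsilon_X\circ(p\otimes\mathrm{id}_{\overline X})\circ(\eta\otimes\varepsilon_X)$ and $$\partial X_1=d(X_1)^{-1}\,(\mathrm{id}_\Gamma\otimes\overline\varepsilon_X)\circ\big((c_{\Gamma,X}^{-1}\circ c_{X,\Gamma}^{-1})\otimes\mathrm{id}_{\overline X}\big)\circ(\mathrm{id}_\Gamma\otimes p\otimes\mathrm{id}_{\overline X})\circ(\Delta\otimes\varepsilon_X)\in\mathrm{End}_{\mathcal C}(\Gamma).$$ This is an element of $G$ depending only on the isomorphism class of $X_1$. A nonzero object is homogeneous of grade $g\in G$ if it is isomorphic to a finite direct sum of simple objects all of grade $g$; $(\mathcal C\rtimes\mathcal S)_g$ is the full subcategory of these. $\mathrm{Spec}\,(\mathcal C\rtimes\mathcal S)=\{g\in G\mid(\mathcal C\rtimes\mathcal S)_g\neq\emptyset\}$. *)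

(* Defs.v *)
From HB Require Import structures.
From mathcomp Require Import all_boot all_order all_fingroup all_algebra.
From mathcomp Require Import boolp classical_sets reals complex.

Set Implicit Arguments.
Unset Strict Implicit.
Unset Printing Implicit Defensive.

Import GRing.Theory.
Local Open Scope classical_set_scope.
Local Open Scope ring_scope.

Declare Scope btc_scope.
Delimit Scope btc_scope with btc.
Reserved Notation "t ∘ s" (at level 45, left associativity).
Reserved Notation "X ⊗ Y" (at level 40, left associativity).
Reserved Notation "s ⊠ t" (at level 40, left associativity).
Reserved Notation "t ∘^ s" (at level 45, left associativity).

Record lincat (F : fieldType) := LinCat {
  lc_ob :> Type;
  Mor : lc_ob -> lc_ob -> vectType F;
  idmor : forall X, Mor X X;
  compm : forall X Y Z, Mor Y Z -> Mor X Y -> Mor X Z;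
  comp_idl : forall X Y (s : Mor X Y), compm (idmor Y) s = s;
  comp_idr : forall X Y (s : Mor X Y), compm s (idmor X) = s;
  compA : forall W X Y Z (u : Mor Y Z) (t : Mor X Y) (s : Mor W X),
    compm u (compm t s) = compm (compm u t) s;
  comp_linl : forall X Y Z (a : F) (t t' : Mor Y Z) (s : Mor X Y),
    compm (a *: t + t') s = a *: compm t s + compm t' s;
  comp_linr : forall X Y Z (a : F) (t : Mor Y Z) (s s' : Mor X Y),
    compm t (a *: s + s') = a *: compm t s + compm t s' }.

Arguments Mor {F l} X Y.
Arguments idmor {F l} X.
Arguments compm {F l X Y Z} _ _.
Notation "t ∘ s" := (compm t s) : btc_scope.
Local Open Scope btc_scope.

Definition iso_ob (F : fieldType) (C : lincat F) (X Y : C) : Prop :=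
  exists (s : Mor X Y) (t : Mor Y X), t ∘ s = idmor X /\ s ∘ t = idmor Y.

(** [dirsum Y X]: X is a direct sum of the finite family Y; for n = 0 this
    says that X is a zero object. *)
Definition dirsum (F : fieldType) (C : lincat F) (n : nat) (Y : 'I_n -> C)
    (X : C) : Prop :=
  exists (u : forall i, Mor (Y i) X) (v : forall i, Mor X (Y i)),
    [/\ forall i, v i ∘ u i = idmor (Y i),
        forall i j, i != j -> v j ∘ u i = 0
      & \sum_(i < n) (u i ∘ v i) = idmor X].

Definition simple_ob (F : fieldType) (C : lincat F) (X : C) : Prop :=
  idmor X <> 0 /\ forall s : Mor X X, exists a : F, s = a *: idmor X.

(** The last condition is Schur's lemma; it does not follow from the others
    because [simple_ob] is a condition on the endomorphisms only. *)
Record semisimple (F : fieldType) (C : lincat F) : Prop := Semisimple {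
  ss_sums : forall (n : nat) (Y : 'I_n -> C), exists X, dirsum Y X;
  ss_split : forall (X : C) (e : Mor X X), e ∘ e = e ->
    exists (Y : C) (u : Mor Y X) (v : Mor X Y), v ∘ u = idmor Y /\ u ∘ v = e;
  ss_decomp : forall X : C, exists (n : nat) (Y : 'I_n -> C),
    (forall i, simple_ob (Y i)) /\ dirsum Y X;
  ss_schur : forall X Y : C, simple_ob X -> simple_ob Y -> ~ iso_ob X Y ->
    forall s : Mor X Y, s = 0 }.

(** The identity morphism between two objects that are equal, but not
    definitionally so: in a strict tensor category the associativity and unit
    constraints have this form. *)
Definition eqm (F : fieldType) (C : lincat F) (X Y : C) (e : X = Y) : Mor X Y :=
  match e in _ = Z return Mor X Z with erefl => idmor X end.

Record strict_tensor_cat (F : fieldType) := StrictTensorCat {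
  tc_cat :> lincat F;
  tunit : tc_cat;
  tens : tc_cat -> tc_cat -> tc_cat;
  tensm : forall X X' Y Y' : tc_cat,
    Mor X X' -> Mor Y Y' -> Mor (tens X Y) (tens X' Y');
  tensA : forall X Y Z, tens X (tens Y Z) = tens (tens X Y) Z;
  tens1x : forall X, tens tunit X = X;
  tensx1 : forall X, tens X tunit = X;
  tensm_id : forall X Y, tensm (idmor X) (idmor Y) = idmor (tens X Y);
  tensm_comp : forall (X X' X'' Y Y' Y'' : tc_cat)
      (s' : Mor X' X'') (s : Mor X X') (t' : Mor Y' Y'') (t : Mor Y Y'),
    tensm (s' ∘ s) (t' ∘ t) = tensm s' t' ∘ tensm s t;
  tensm_linl : forall (X X' Y Y' : tc_cat) (a : F) (s s' : Mor X X')
      (t : Mor Y Y'),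
    tensm (a *: s + s') t = a *: tensm s t + tensm s' t;
  tensm_linr : forall (X X' Y Y' : tc_cat) (a : F) (s : Mor X X')
      (t t' : Mor Y Y'),
    tensm s (a *: t + t') = a *: tensm s t + tensm s t';
  tensmA : forall (X X' Y Y' Z Z' : tc_cat)
      (s : Mor X X') (t : Mor Y Y') (u : Mor Z Z'),
    eqm (tensA X' Y' Z') ∘ tensm s (tensm t u) =
    tensm (tensm s t) u ∘ eqm (tensA X Y Z);
  tensm1x : forall (X X' : tc_cat) (s : Mor X X'),
    eqm (tens1x X') ∘ tensm (idmor tunit) s = s ∘ eqm (tens1x X);
  tensmx1 : forall (X X' : tc_cat) (s : Mor X X'),
    eqm (tensx1 X') ∘ tensm s (idmor tunit) = s ∘ eqm (tensx1 X) }.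

Arguments tunit {_ _}.
Arguments tens {_ _} _ _.
Arguments tensm {_ _ _ _ _ _} _ _.
Arguments tensA {_ _} _ _ _.
Arguments tens1x {_ _} _.
Arguments tensx1 {_ _} _.
Notation "X ⊗ Y" := (tens X Y) : btc_scope.
Notation "s ⊠ t" := (tensm s t) : btc_scope.

(** The identity X⊗(Y⊗Z) -> (X⊗Y)⊗Z and its inverse. *)
Definition asc (F : fieldType) (C : strict_tensor_cat F) (X Y Z : C) :
  Mor (X ⊗ (Y ⊗ Z)) (X ⊗ Y ⊗ Z) := eqm (tensA X Y Z).
Definition asci (F : fieldType) (C : strict_tensor_cat F) (X Y Z : C) :
  Mor (X ⊗ Y ⊗ Z) (X ⊗ (Y ⊗ Z)) := eqm (esym (tensA X Y Z)).

Record BTC (F : fieldType) := MkBTC {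
  btc_cat :> strict_tensor_cat F;
  btc_semisimple : semisimple btc_cat;
  btc_one : simple_ob (tunit : btc_cat);
  br : forall X Y : btc_cat, Mor (X ⊗ Y) (Y ⊗ X);
  bri : forall X Y : btc_cat, Mor (Y ⊗ X) (X ⊗ Y);
  brK : forall X Y, bri X Y ∘ br X Y = idmor (X ⊗ Y);
  briK : forall X Y, br X Y ∘ bri X Y = idmor (Y ⊗ X);
  br_nat : forall (X X' Y Y' : btc_cat) (s : Mor X X') (t : Mor Y Y'),
    br X' Y' ∘ (s ⊠ t) = (t ⊠ s) ∘ br X Y;
  br_tensr : forall X Y Z : btc_cat,
    br X (Y ⊗ Z) = asc Y Z X ∘ (idmor Y ⊠ br X Z) ∘ asci Y X Z
                     ∘ (br X Y ⊠ idmor Z) ∘ asc X Y Z;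
  br_tensl : forall X Y Z : btc_cat,
    br (X ⊗ Y) Z = asci Z X Y ∘ (br X Z ⊠ idmor Y) ∘ asc X Z Y
                     ∘ (idmor X ⊠ br Y Z) ∘ asci X Y Z;
  dual : btc_cat -> btc_cat;
  coev : forall X : btc_cat, Mor tunit (X ⊗ dual X);
  ev : forall X : btc_cat, Mor (dual X ⊗ X) tunit;
  zigzag : forall X : btc_cat,
    eqm (tensx1 X) ∘ (idmor X ⊠ ev X) ∘ asci X (dual X) X
      ∘ (coev X ⊠ idmor X) ∘ eqm (esym (tens1x X)) = idmor X;
  zigzag_dual : forall X : btc_cat,
    eqm (tens1x (dual X)) ∘ (ev X ⊠ idmor (dual X)) ∘ asc (dual X) X (dual X)
      ∘ (idmor (dual X) ⊠ coev X) ∘ eqm (esym (tensx1 (dual X))) = idmor (dual X);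
  twist : forall X : btc_cat, Mor X X;
  twist_inv : forall X, exists t : Mor X X,
    t ∘ twist X = idmor X /\ twist X ∘ t = idmor X;
  twist_nat : forall (X Y : btc_cat) (s : Mor X Y),
    twist Y ∘ s = s ∘ twist X;
  twist_tens : forall X Y : btc_cat,
    twist (X ⊗ Y) = br Y X ∘ br X Y ∘ (twist X ⊠ twist Y);
  twist_dual : forall X : btc_cat,
    (twist X ⊠ idmor (dual X)) ∘ coev X = (idmor X ⊠ twist (dual X)) ∘ coev X }.

Arguments br {F b} X Y.
Arguments bri {F b} X Y.
Arguments dual {F b} X.
Arguments coev {F b} X.
Arguments ev {F b} X.
Arguments twist {F b} X.

(** The morphism X ⊗ X^* -> 1 of the spherical structure determined by the
    braiding and the twist. *)
Definition evbar (F : fieldType) (C : BTC F) (X : C) : Mor (X ⊗ dual X) tunit :=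
  ev X ∘ br X (dual X) ∘ (twist X ⊠ idmor (dual X)).

(** The scalar a with s = a id_1. *)
Definition scal (F : fieldType) (C : BTC F) (s : Mor (tunit : C) tunit) : F :=
  coord [tuple idmor (tunit : C)] ord0 s.

Definition qdim (F : fieldType) (C : BTC F) (X : C) : F :=
  scal (evbar X ∘ coev X).

Record tensor_subcat (F : fieldType) (C : BTC F) (S : set C) : Prop := {
  sub_one : S tunit;
  sub_tens : forall X Y, S X -> S Y -> S (X ⊗ Y);
  sub_dual : forall X, S X -> S (dual X);
  sub_sums : forall (n : nat) (Y : 'I_n -> C) (X : C),
    (forall i, S (Y i)) -> dirsum Y X -> S X;
  sub_sub : forall (X Y : C) (u : Mor Y X) (v : Mor X Y),
    v ∘ u = idmor Y -> S X -> S Y }.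

Definition symmetric_on (F : fieldType) (C : BTC F) (S : set C) : Prop :=
  forall X Y : C, S X -> S Y -> br Y X ∘ br X Y = idmor (X ⊗ Y).

Definition finite_on (F : fieldType) (C : BTC F) (S : set C) : Prop :=
  exists (n : nat) (Y : 'I_n -> C),
    forall X : C, S X -> simple_ob X -> exists i, iso_ob X (Y i).

(** [cj] is the complex conjugation of some identification of F with the
    field of complex numbers. *)
Definition complex_conj (F : fieldType) (cj : F -> F) : Prop :=
  exists (R : realType) (phi : {rmorphism F -> R[i]}),
    bijective phi /\ forall a, phi (cj a) = (phi a)^*%C.

(** The values of [star] on morphisms outside S are irrelevant. *)
Definition star_category (F : fieldType) (C : BTC F) (S : set C) : Prop :=
  exists (cj : F -> F) (star : forall X Y : C, Mor X Y -> Mor Y X),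
    complex_conj cj /\
    [/\ forall X Y (a : F) (s t : Mor X Y), S X -> S Y ->
          star X Y (a *: s + t) = cj a *: star X Y s + star X Y t,
        forall X, S X -> star X X (idmor X) = idmor X,
        forall X Y Z (s : Mor X Y) (t : Mor Y Z), S X -> S Y -> S Z ->
          star X Z (t ∘ s) = star X Y s ∘ star Y Z t,
        forall X X' Y Y' (s : Mor X X') (t : Mor Y Y'),
          S X -> S X' -> S Y -> S Y' ->
          star (X ⊗ Y) (X' ⊗ Y') (s ⊠ t) = star X X' s ⊠ star Y Y' t
      & (forall X Y (s : Mor X Y), S X -> S Y -> star Y X (star X Y s) = s) /\
        (forall X Y (s : Mor X Y), S X -> S Y -> star X Y s ∘ s = 0 -> s = 0)].

(** Trivial twist is required in both cases; in the second one it is the twist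
    with respect to which the dimension is meant. *)
Definition admissible (F : fieldType) (C : BTC F) (S : set C) : Prop :=
  (forall X : C, S X -> twist X = idmor X) /\
  (star_category S \/ forall X : C, S X -> exists n : nat, qdim X = n%:R).

Record finite_admissible_STC (F : fieldType) (C : BTC F) (S : set C) : Prop := {
  fa_subcat : tensor_subcat S;
  fa_symmetric : symmetric_on S;
  fa_finite : finite_on S;
  fa_admissible : admissible S }.

Definition Z2 (F : fieldType) (C : BTC F) : set C :=
  [set X | forall Y : C, br X Y ∘ br Y X = idmor (Y ⊗ X)].
Arguments Z2 {F} C _.

Record rep (F : fieldType) (gT : finGroupType) := Rep {
  rep_sort :> vectType F;
  ract : gT -> 'End(rep_sort);
  ract1 : ract 1%g = \1%VF;
  ractM : forall g h, ract (g * h)%g = (ract g \o ract h)%VF }.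

Definition equivariant (F : fieldType) (gT : finGroupType) (V W : rep F gT)
    (f : 'Hom(V, W)) : Prop :=
  forall g v, f (ract V g v) = ract W g (f v).

(** Data of a tensor functor to Rep G. The isomorphisms E X ⊗ E Y -> E (X ⊗ Y)
    are presented by the corresponding bilinear maps. *)
Record rep_functor (F : fieldType) (C : BTC F) (gT : finGroupType) := RepFunctor {
  fob :> C -> rep F gT;
  fmor : forall X Y : C, Mor X Y -> 'Hom(fob X, fob Y);
  fone : fob tunit;
  ften : forall X Y : C, fob X -> fob Y -> fob (X ⊗ Y) }.

Arguments fmor {F C gT} E {X Y} s : rename.
Arguments fone {F C gT} E : rename.
Arguments ften {F C gT} E {X Y} x y : rename.

(** E restricts to an equivalence S -> Rep G of symmetric tensor categories;
    its values outside S are irrelevant. The conditions [eq_tenb] and [eq_oneb]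
    express that E X ⊗ E Y -> E (X ⊗ Y) and F -> E 1 are bijective. *)
Record sym_tensor_equiv (F : fieldType) (C : BTC F) (S : set C)
    (gT : finGroupType) (E : rep_functor C gT) : Prop := {
  eq_lin : forall X Y (a : F) (s t : Mor X Y), S X -> S Y ->
    fmor E (a *: s + t) = a *: fmor E s + fmor E t;
  eq_id : forall X, S X -> fmor E (idmor X) = \1%VF;
  eq_comp : forall X Y Z (t : Mor Y Z) (s : Mor X Y), S X -> S Y -> S Z ->
    fmor E (t ∘ s) = (fmor E t \o fmor E s)%VF;
  eq_equiv : forall X Y (s : Mor X Y), S X -> S Y -> equivariant (fmor E s);
  eq_tenl : forall X Y (a : F) (x x' : E X) (y : E Y), S X -> S Y ->
    ften E (a *: x + x') y = a *: ften E x y + ften E x' y;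
  eq_tenr : forall X Y (a : F) (x : E X) (y y' : E Y), S X -> S Y ->
    ften E x (a *: y + y') = a *: ften E x y + ften E x y';
  eq_tenb : forall X Y, S X -> S Y ->
    basis_of {: E (X ⊗ Y)}
      [seq ften E x y | x <- vbasis {: E X}, y <- vbasis {: E Y}];
  eq_oneb : basis_of {: E tunit} [:: fone E];
  eq_tenG : forall X Y g (x : E X) (y : E Y), S X -> S Y ->
    ract (E (X ⊗ Y)) g (ften E x y) = ften E (ract (E X) g x) (ract (E Y) g y);
  eq_oneG : forall g, ract (E tunit) g (fone E) = fone E;
  eq_ten_nat : forall X X' Y Y' (s : Mor X X') (t : Mor Y Y') (x : E X) (y : E Y),
    S X -> S X' -> S Y -> S Y' ->
    fmor E (s ⊠ t) (ften E x y) = ften E (fmor E s x) (fmor E t y);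
  eq_tenA : forall X Y Z (x : E X) (y : E Y) (z : E Z), S X -> S Y -> S Z ->
    fmor E (asc X Y Z) (ften E x (ften E y z)) = ften E (ften E x y) z;
  eq_ten1x : forall X (x : E X), S X ->
    fmor E (eqm (tens1x X)) (ften E (fone E) x) = x;
  eq_tenx1 : forall X (x : E X), S X ->
    fmor E (eqm (tensx1 X)) (ften E x (fone E)) = x;
  eq_br : forall X Y (x : E X) (y : E Y), S X -> S Y ->
    fmor E (br X Y) (ften E x y) = ften E y x;
  eq_faithful : forall X Y (s t : Mor X Y), S X -> S Y ->
    fmor E s = fmor E t -> s = t;
  eq_full : forall X Y (f : 'Hom(E X, E Y)), S X -> S Y -> equivariant f ->
    exists s : Mor X Y, fmor E s = f;
  eq_esurj : forall V : rep F gT, exists (X : C) (f : 'Hom(V, E X)),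
    [/\ S X, equivariant f & bijective f] }.

Definition ltrans (F : fieldType) (gT : finGroupType) (g : gT)
    (f : {ffun gT -> F^o}) : {ffun gT -> F^o} := [ffun h => f (g^-1 * h)%g].

Lemma ltrans_linear (F : fieldType) (gT : finGroupType) (g : gT) :
  linear (@ltrans F gT g).
Proof. by move=> a f f'; apply/ffunP => h; rewrite !ffunE. Qed.

HB.instance Definition _ (F : fieldType) (gT : finGroupType) (g : gT) :=
  GRing.isLinear.Build F {ffun gT -> F^o} {ffun gT -> F^o} _ (@ltrans F gT g)
    (@ltrans_linear F gT g).

Lemma ltrans1 (F : fieldType) (gT : finGroupType) :
  linfun (@ltrans F gT 1%g) = \1%VF.
Proof.
by apply/lfunP => f; rewrite !lfunE /=; apply/ffunP => h;
  rewrite !ffunE invg1 mul1g.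
Qed.

Lemma ltransM (F : fieldType) (gT : finGroupType) (g h : gT) :
  linfun (@ltrans F gT (g * h)%g) =
  (linfun (@ltrans F gT g) \o linfun (@ltrans F gT h))%VF.
Proof.
by apply/lfunP => f; rewrite comp_lfunE !lfunE /=; apply/ffunP => k;
  rewrite !ffunE invMg mulgA.
Qed.

Definition regrep (F : fieldType) (gT : finGroupType) : rep F gT :=
  Rep (ltrans1 F gT) (@ltransM F gT).

Definition deltaG (F : fieldType) (gT : finGroupType) (g : gT) : regrep F gT :=
  [ffun h => (h == g)%:R].

Record frob_data (F : fieldType) (C : BTC F) := FrobData {
  Gam : C;
  amul : Mor (Gam ⊗ Gam) Gam;
  aunt : Mor tunit Gam;
  acomul : Mor Gam (Gam ⊗ Gam);
  acnt : Mor Gam tunit }.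

Definition regular_frobenius (F : fieldType) (C : BTC F) (S : set C)
    (gT : finGroupType) (E : rep_functor C gT) (A : frob_data C) : Prop :=
  S (Gam A) /\
  exists u : 'Hom(regrep F gT, E (Gam A)),
    [/\ equivariant u /\ bijective u,
        forall f f' : regrep F gT,
          fmor E (amul A) (ften E (u f) (u f')) = u [ffun h => f h * f' h],
        fmor E (aunt A) (fone E) = u [ffun=> 1],
        forall g, fmor E (acomul A) (u (deltaG F g)) =
          #|gT|%:R *: ften E (u (deltaG F g)) (u (deltaG F g))
      & forall g, fmor E (acnt A) (u (deltaG F g)) = #|gT|%:R^-1 *: fone E].

Definition AutAlg (F : fieldType) (C : BTC F) (A : frob_data C) :
    set (Mor (Gam A) (Gam A)) :=
  [set g | g ∘ amul A = amul A ∘ (g ⊠ g) /\ g ∘ aunt A = aunt A].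
Arguments AutAlg {F C} A _.

(** q is the idempotent of Γ whose image Γ0 is the sum of the isotypic
    components of Γ belonging to S0: Γ is the direct sum of Γ0 in S0 and of an
    object Z without nonzero morphisms from objects of S0. *)
Definition isotypic_idempotent (F : fieldType) (C : BTC F) (S0 : set C) (X : C)
    (q : Mor X X) : Prop :=
  exists (X0 Z : C) (i : Mor X0 X) (r : Mor X X0) (j : Mor Z X) (t : Mor X Z),
    [/\ r ∘ i = idmor X0, t ∘ j = idmor Z, i ∘ r + j ∘ t = idmor X, q = i ∘ r
      & S0 X0 /\ forall (Y : C) (s : Mor Y Z), S0 Y -> s = 0].

Definition normal_subgroup_of (F : fieldType) (C : BTC F) (A : frob_data C)
    (S0 : set C) : set (Mor (Gam A) (Gam A)) :=
  [set g | AutAlg A g /\ exists2 q, isotypic_idempotent S0 q & g ∘ q = q].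
Arguments normal_subgroup_of {F C} A S0 _.

(** The category C ⋊0 S has Mor (Γ ⊗ X) Y as the space of morphisms X -> Y, with
    the following composition. The identity of X is the counit tensored with X. *)
Definition hcomp (F : fieldType) (C : BTC F) (A : frob_data C) (X Y Z : C)
    (t : Mor (Gam A ⊗ Y) Z) (s : Mor (Gam A ⊗ X) Y) : Mor (Gam A ⊗ X) Z :=
  t ∘ (idmor (Gam A) ⊠ s) ∘ asci (Gam A) (Gam A) X ∘ (acomul A ⊠ idmor X).

Notation "t ∘^ s" := (hcomp t s) : btc_scope.

(** Objects (X, p) of C ⋊ S; for p as below, p is the identity of (X, p). *)
Record gobj (F : fieldType) (C : BTC F) (A : frob_data C) := GObj {
  gcar : C;
  gidem : Mor (Gam A ⊗ gcar) gcar;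
  gidemP : gidem ∘^ gidem = gidem }.

(** The morphisms (X, p) -> (Y, q) of C ⋊ S. *)
Definition ghom (F : fieldType) (C : BTC F) (A : frob_data C) (P Q : gobj A) :
    set (Mor (Gam A ⊗ gcar P) (gcar Q)) :=
  [set s | gidem Q ∘^ (s ∘^ gidem P) = s].
Arguments ghom {F C A} P Q _.

(** As in [dirsum], P is only determined up to isomorphism. *)
Definition gdirsum (F : fieldType) (C : BTC F) (A : frob_data C) (n : nat)
    (Q : 'I_n -> gobj A) (P : gobj A) : Prop :=
  exists (u : forall i, Mor (Gam A ⊗ gcar (Q i)) (gcar P))
         (v : forall i, Mor (Gam A ⊗ gcar P) (gcar (Q i))),
    [/\ forall i, ghom (Q i) P (u i) /\ ghom P (Q i) (v i),
        forall i, v i ∘^ u i = gidem (Q i),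
        forall i j, i != j -> v j ∘^ u i = 0
      & \sum_(i < n) (u i ∘^ v i) = gidem P].

Definition gsimple (F : fieldType) (C : BTC F) (A : frob_data C) (P : gobj A) :
    Prop :=
  gidem P <> 0 /\ forall s, ghom P P s -> exists a : F, s = a *: gidem P.

(** The dimension of (X, p). *)
Definition gdim (F : fieldType) (C : BTC F) (A : frob_data C) (P : gobj A) : F :=
  let X := gcar P in
  scal (evbar X ∘ (gidem P ⊠ idmor (dual X)) ∘ asc (Gam A) X (dual X)
          ∘ (aunt A ⊠ coev X) ∘ eqm (esym (tens1x tunit))).

Lemma tensA4 (F : fieldType) (C : strict_tensor_cat F) (W X Y Z : C) :
  (W ⊗ X) ⊗ (Y ⊗ Z) = W ⊗ (X ⊗ Y ⊗ Z).
Proof. by rewrite !tensA. Qed.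

(** The endomorphism ∂(X, p) of Γ. *)
Definition grade (F : fieldType) (C : BTC F) (A : frob_data C) (P : gobj A) :
    Mor (Gam A) (Gam A) :=
  let G := Gam A in let X := gcar P in
  (gdim P)^-1 *:
   (eqm (tensx1 G) ∘ (idmor G ⊠ evbar X) ∘ asci G X (dual X)
      ∘ ((bri G X ∘ bri X G) ⊠ idmor (dual X))
      ∘ asc G X (dual X) ∘ (idmor G ⊠ (gidem P ⊠ idmor (dual X)))
      ∘ eqm (tensA4 G G X (dual X)) ∘ (acomul A ⊠ coev X)
      ∘ eqm (esym (tensx1 G))).

Definition homogeneous (F : fieldType) (C : BTC F) (A : frob_data C)
    (g : Mor (Gam A) (Gam A)) : set (gobj A) :=
  [set P | gidem P <> 0 /\ exists (n : nat) (Q : 'I_n -> gobj A),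
     (forall i, gsimple (Q i) /\ grade (Q i) = g) /\ gdirsum Q P].

Definition Spec (F : fieldType) (C : BTC F) (A : frob_data C) :
    set (Mor (Gam A) (Gam A)) :=
  [set g | AutAlg A g /\ homogeneous g !=set0].
Arguments Spec {F C} A _.

(* Main.v *)
(** The inverse monodromy of Γ and X is the sum over k in G of
    [(k ⊗ π_k) ∘ (Δ ⊗ X)], where π_k is an endomorphism of X in C ⋊ S on whose
    image the inverse monodromy acts as k: it is graded by k. Let H be the set of
    the k that grade some nonzero morphism of C ⋊ S. The tensor product of
    morphisms graded by k and l is graded by kl, and it is nonzero by a partial
    trace; so H is a subgroup of G. The H-invariants of Γ have trivial monodromy
    with every X, hence lie in S ∩ Z_2 and are contained in Γ_0, so that k in N
    fixes them; thus N is contained in H. The endomorphism algebras of C ⋊ S are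
    von Neumann regular, so a morphism graded by k yields a simple object of
    nonzero dimension on which the inverse monodromy acts as k; thus H is
    contained in Spec. Finally Spec is contained in N since the monodromy of Γ_0
    with every X is trivial. *)
From HB Require Import structures.
Require Import Defs.
From mathcomp Require Import all_boot all_fingroup all_algebra.
From mathcomp Require Import boolp classical_sets.

Set Implicit Arguments.
Unset Strict Implicit.
Unset Printing Implicit Defensive.

Import GRing.Theory.
Local Open Scope classical_set_scope.
Local Open Scope ring_scope.
Local Open Scope btc_scope.

(** * Strict tensor categories without associativity isomorphisms *)

(** The formula for the grade divides by a dimension, so a grade is only meaningful for objects of
    nonzero dimension. Showing directly that the spectrum is closed under products would require
    decomposing tensor products of simple objects and finding a summand of nonzero dimension;
    gradings of arbitrary morphisms avoid this. Nonvanishing comes from $\mathcal C$ instead: a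
    nonzero graded morphism can be composed to a graded s with $s\circ(\eta\otimes Y)=\mathrm{id}$
    and Y simple in $\mathcal C$, and the trace of s is then $d(Y)\neq0$. The rest is algebra: in a
    von Neumann regular algebra over an algebraically closed field, if a linear form is nonzero on
    s, it is nonzero on some primitive idempotent in the right ideal of s. The components $\pi_k$
    arise by doubling Γ and crossing X with one copy by the braiding, with the other by its inverse.
    The form $\varepsilon\circ m\circ(k\otimes\Gamma)$ pairs the two copies and so selects the part
    where the second is the image of the first under k. Characteristic zero makes $|G|$ and $|H|$
    invertible. *)

Section LinCat.
Variables (F : fieldType) (C : lincat F).
Implicit Types X Y Z : C.

Lemma comp0m X Y Z (s : Mor X Y) : (0 : Mor Y Z) ∘ s = 0.
Proof.
have := comp_linl 1 0 (0 : Mor Y Z) s; rewrite !scale1r addr0.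
by move/esym/(canRL (addrK _)); rewrite subrr.
Qed.

Lemma compm0 X Y Z (s : Mor Y Z) : s ∘ (0 : Mor X Y) = 0.
Proof.
have := comp_linr 1 s (0 : Mor X Y) 0; rewrite !scale1r addr0.
by move/esym/(canRL (addrK _)); rewrite subrr.
Qed.

Lemma compZl X Y Z a (t : Mor Y Z) (s : Mor X Y) : (a *: t) ∘ s = a *: (t ∘ s).
Proof. by rewrite -[a *: t]addr0 comp_linl comp0m addr0. Qed.

Lemma compZr X Y Z a (t : Mor Y Z) (s : Mor X Y) : t ∘ (a *: s) = a *: (t ∘ s).
Proof. by rewrite -[a *: s]addr0 comp_linr compm0 addr0. Qed.

Lemma compDl X Y Z (t t' : Mor Y Z) (s : Mor X Y) : (t + t') ∘ s = t ∘ s + t' ∘ s.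
Proof. by rewrite -{1}[t]scale1r comp_linl scale1r. Qed.

Lemma compDr X Y Z (t : Mor Y Z) (s s' : Mor X Y) : t ∘ (s + s') = t ∘ s + t ∘ s'.
Proof. by rewrite -{1}[s]scale1r comp_linr scale1r. Qed.

Lemma compBl X Y Z (t t' : Mor Y Z) (s : Mor X Y) : (t - t') ∘ s = t ∘ s - t' ∘ s.
Proof. by rewrite compDl -scaleN1r compZl scaleN1r. Qed.

Lemma compBr X Y Z (t : Mor Y Z) (s s' : Mor X Y) : t ∘ (s - s') = t ∘ s - t ∘ s'.
Proof. by rewrite compDr -scaleN1r compZr scaleN1r. Qed.

Lemma comp_suml X Y Z (I : finType) (P : pred I) (t : I -> Mor Y Z) (s : Mor X Y) :
  (\sum_(i | P i) t i) ∘ s = \sum_(i | P i) (t i ∘ s).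
Proof.
by apply: (big_morph (fun t => t ∘ s)) => [t1 t2|]; rewrite ?compDl ?comp0m.
Qed.

Lemma comp_sumr X Y Z (I : finType) (P : pred I) (t : Mor Y Z) (s : I -> Mor X Y) :
  t ∘ (\sum_(i | P i) s i) = \sum_(i | P i) (t ∘ s i).
Proof.
by apply: (big_morph (fun s => t ∘ s)) => [t1 t2|]; rewrite ?compDr ?compm0.
Qed.

End LinCat.

Reserved Notation "g • f" (at level 43, right associativity).
Reserved Notation "X ◁ f" (at level 36, right associativity).
Reserved Notation "f ▷ X" (at level 33, left associativity).
Reserved Notation "⟨ s ⟩" (at level 0, s at level 99, format "⟨ s ⟩").

Section Arrows.
Variables (F : fieldType) (C : strict_tensor_cat F).
Implicit Types X Y Z : C.

Lemma eqm_id X (e : X = X) : eqm e = idmor X.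
Proof. by rewrite (Prop_irrelevance e erefl). Qed.

Lemma tensmZl X X' Y Y' a (s : Mor X X') (t : Mor Y Y') :
  (a *: s) ⊠ t = a *: (s ⊠ t).
Proof.
have h0 : (0 : Mor X X') ⊠ t = 0.
  have := tensm_linl 1 0 (0 : Mor X X') t; rewrite !scale1r addr0.
  by move/esym/(canRL (addrK _)); rewrite subrr.
by rewrite -[a *: s]addr0 tensm_linl h0 addr0.
Qed.

Lemma tensmZr X X' Y Y' a (s : Mor X X') (t : Mor Y Y') :
  s ⊠ (a *: t) = a *: (s ⊠ t).
Proof.
have h0 : s ⊠ (0 : Mor Y Y') = 0.
  have := tensm_linr 1 s (0 : Mor Y Y') 0; rewrite !scale1r addr0.
  by move/esym/(canRL (addrK _)); rewrite subrr.
by rewrite -[a *: t]addr0 tensm_linr h0 addr0.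
Qed.

Lemma tensm0 X X' Y Y' (s : Mor X X') : s ⊠ (0 : Mor Y Y') = 0.
Proof. by rewrite -[0](scale0r (0 : Mor Y Y')) tensmZr scale0r. Qed.

Lemma tens0m X X' Y Y' (s : Mor X X') : (0 : Mor Y Y') ⊠ s = 0.
Proof. by rewrite -[0](scale0r (0 : Mor Y Y')) tensmZl scale0r. Qed.

Lemma tensm_sumr X X' Y Y' (I : finType) (P : pred I) (s : Mor X X') (t : I -> Mor Y Y') :
  s ⊠ (\sum_(i | P i) t i) = \sum_(i | P i) (s ⊠ t i).
Proof.
apply: (big_morph (fun t => s ⊠ t)) => [t1 t2|]; rewrite ?tensm0 //.
by rewrite -{1}[t1]scale1r tensm_linr scale1r.
Qed.

Lemma tensm_suml X X' Y Y' (I : finType) (P : pred I) (s : Mor X X') (t : I -> Mor Y Y') :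
  (\sum_(i | P i) t i) ⊠ s = \sum_(i | P i) (t i ⊠ s).
Proof.
apply: (big_morph (fun t => t ⊠ s)) => [t1 t2|]; rewrite ?tens0m //.
by rewrite -{1}[t1]scale1r tensm_linl scale1r.
Qed.

(** A morphism together with its source and target: equality of arrows ignores
    the identifications of objects [eqm], so that the tensor product of arrows is
    associative on the nose. The composite of arrows that do not match is 0. *)
Record arrow := Arrow { asrc : C; atgt : C; amor : Mor asrc atgt }.

Definition acomp (g f : arrow) : arrow :=
  match pselect (atgt f = asrc g) with
  | left e => Arrow (amor g ∘ eqm e ∘ amor f)
  | right _ => Arrow (0 : Mor (asrc f) (atgt g))
  end.

Definition lwh X (f : arrow) := Arrow (idmor X ⊠ amor f).
Definition rwh (f : arrow) X := Arrow (amor f ⊠ idmor X).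

Local Notation "⟨ s ⟩" := (Arrow s).
Local Notation "g • f" := (acomp g f).
Local Notation "X ◁ f" := (lwh X f).
Local Notation "f ▷ X" := (rwh f X).

Lemma arrow_eq (a b : arrow) : a = b ->
  exists (e1 : asrc a = asrc b) (e2 : atgt a = atgt b),
    eqm e2 ∘ amor a = amor b ∘ eqm e1.
Proof. by move=> <-; exists erefl, erefl; rewrite comp_idl comp_idr. Qed.

(** The way back from arrows to morphisms: by proof irrelevance every identification of an object
    with itself is the identity, so nothing is lost. *)
Lemma Arrow_inj X Y (s t : Mor X Y) : ⟨s⟩ = ⟨t⟩ -> s = t.
Proof.
by move/arrow_eq => [e1 [e2]] /=; rewrite !eqm_id comp_idl comp_idr.
Qed.

Lemma asrc_comp g f : asrc (g • f) = asrc f.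
Proof. by rewrite /acomp; case: pselect. Qed.

Lemma atgt_comp g f : atgt (g • f) = atgt g.
Proof. by rewrite /acomp; case: pselect. Qed.

Lemma acompE X Y Z (t : Mor Y Z) (s : Mor X Y) : ⟨t ∘ s⟩ = ⟨t⟩ • ⟨s⟩.
Proof.
rewrite /acomp /=; case: pselect => [e|//].
by rewrite eqm_id comp_idr.
Qed.

Lemma acomp_eqml X Y Z (e : Y = Z) (s : Mor X Y) : ⟨eqm e ∘ s⟩ = ⟨s⟩.
Proof. by case: _ / e; rewrite comp_idl. Qed.

Lemma acomp_eqmr X Y Z (e : Z = X) (s : Mor X Y) : ⟨s ∘ eqm e⟩ = ⟨s⟩.
Proof. by case: X / e s => s; rewrite comp_idr. Qed.

Lemma Arrow_eqm X Y (e : X = Y) : ⟨eqm e⟩ = ⟨idmor X⟩.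
Proof. by case: Y / e. Qed.

Lemma acomp_idl Y (f : arrow) : atgt f = Y -> ⟨idmor Y⟩ • f = f.
Proof. by case: f => X Z s /= <-; rewrite -acompE comp_idl. Qed.

Lemma acomp_idr X (f : arrow) : asrc f = X -> f • ⟨idmor X⟩ = f.
Proof. by case: f => W Z s /= <-; rewrite -acompE comp_idr. Qed.

Lemma acomp_mismatch X Y Y' Z (t : Mor Y' Z) (s : Mor X Y) :
  Y <> Y' -> ⟨t⟩ • ⟨s⟩ = ⟨0 : Mor X Z⟩.
Proof. by move=> nY; rewrite /acomp /=; case: pselect. Qed.

(** The value 0 for mismatched composites makes this unconditional, so reassociating leaves no side
    goals. *)
Lemma acompA h g f : h • (g • f) = (h • g) • f.
Proof.
case: f g h => X Y s [Y' Z t] [Z' W u].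
have [e|nY] := pselect (Y = Y'); have [e'|nZ] := pselect (Z = Z').
- by case: Y' / e t => t; case: Z' / e' u => u; rewrite -!acompE Defs.compA.
- by case: Y' / e t => t; rewrite (acomp_mismatch u t) // -!acompE
    (acomp_mismatch u) // comp0m.
- by case: Z' / e' u => u; rewrite (acomp_mismatch t s) // -!acompE
    (acomp_mismatch _ s) // compm0.
- by rewrite (acomp_mismatch t s) // (acomp_mismatch u t) // !acomp_mismatch.
Qed.

Lemma tensE X X' Y Y' (s : Mor X X') (t : Mor Y Y') :
  ⟨s ⊠ t⟩ = (⟨s⟩ ▷ Y') • (X ◁ ⟨t⟩).
Proof. by rewrite /lwh /rwh /= -acompE -tensm_comp comp_idl comp_idr. Qed.

Lemma lwhE X Y Y' (t : Mor Y Y') : ⟨idmor X ⊠ t⟩ = X ◁ ⟨t⟩.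
Proof. by []. Qed.

Lemma rwhE X Y Y' (t : Mor Y Y') : ⟨t ⊠ idmor X⟩ = ⟨t⟩ ▷ X.
Proof. by []. Qed.

Lemma wh_exch X X' Y Y' (s : Mor X X') (t : Mor Y Y') :
  (X' ◁ ⟨t⟩) • (⟨s⟩ ▷ Y) = (⟨s⟩ ▷ Y') • (X ◁ ⟨t⟩).
Proof. by rewrite /lwh /rwh /= -!acompE -!tensm_comp !comp_idl !comp_idr. Qed.

Lemma lwh_id X Y : X ◁ ⟨idmor Y⟩ = ⟨idmor (X ⊗ Y)⟩.
Proof. by rewrite /lwh tensm_id. Qed.

Lemma rwh_id X Y : ⟨idmor Y⟩ ▷ X = ⟨idmor (Y ⊗ X)⟩.
Proof. by rewrite /rwh tensm_id. Qed.

Lemma lwh_comp X g f : atgt f = asrc g -> X ◁ (g • f) = (X ◁ g) • (X ◁ f).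
Proof.
case: f g => W Y s [Y' Z t] /= e; case: Y' / e t => t.
by rewrite -acompE /lwh /= -acompE -tensm_comp comp_idl.
Qed.

Lemma rwh_comp X g f : atgt f = asrc g -> (g • f) ▷ X = (g ▷ X) • (f ▷ X).
Proof.
case: f g => W Y s [Y' Z t] /= e; case: Y' / e t => t.
by rewrite -acompE /rwh /= -acompE -tensm_comp comp_idl.
Qed.

Lemma arrow_tensA X X' Y Y' Z Z' (s : Mor X X') (t : Mor Y Y') (u : Mor Z Z') :
  ⟨s ⊠ (t ⊠ u)⟩ = ⟨s ⊠ t ⊠ u⟩.
Proof. by rewrite -(acomp_eqml (tensA X' Y' Z')) tensmA acomp_eqmr. Qed.

Lemma lwh_tens X Y f : (X ⊗ Y) ◁ f = X ◁ (Y ◁ f).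
Proof. by rewrite /lwh /= arrow_tensA tensm_id. Qed.

Lemma rwh_tens X Y f : f ▷ (X ⊗ Y) = f ▷ X ▷ Y.
Proof. by rewrite /rwh /= -arrow_tensA tensm_id. Qed.

Lemma lrwh X Y f : (X ◁ f) ▷ Y = X ◁ (f ▷ Y).
Proof. by rewrite /rwh /lwh /= arrow_tensA. Qed.

Lemma lwh_unit f : tunit ◁ f = f.
Proof.
case: f => X Y s.
by rewrite /lwh /= -(acomp_eqml (tens1x Y)) tensm1x acomp_eqmr.
Qed.

Lemma rwh_unit f : f ▷ tunit = f.
Proof.
case: f => X Y s.
by rewrite /rwh /= -(acomp_eqml (tensx1 Y)) tensmx1 acomp_eqmr.
Qed.

Lemma acomp_reassoc h g f : h • g = f -> forall r, h • (g • r) = f • r.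
Proof. by move=> <- r; rewrite acompA. Qed.

End Arrows.

Notation "⟨ s ⟩" := (Arrow s) : btc_scope.
Notation "g • f" := (acomp g f) : btc_scope.
Notation "X ◁ f" := (lwh X f) : btc_scope.
Notation "f ▷ X" := (rwh f X) : btc_scope.

(** * Half-braidings and grades *)

Lemma acomp_reassoc3 (F : fieldType) (C : strict_tensor_cat F) (h g k f : arrow C) :
  h • (g • k) = f -> forall r, h • (g • (k • r)) = f • r.
Proof. by move=> <- r; rewrite !acompA. Qed.

Lemma acomp_reassoc5 (F : fieldType) (C : strict_tensor_cat F)
    (h g k l n f : arrow C) : h • (g • (k • (l • n))) = f ->
  forall r, h • (g • (k • (l • (n • r)))) = f • r.
Proof. by move=> <- r; rewrite !acompA. Qed.

Lemma lwh_congr (F : fieldType) (C : strict_tensor_cat F) (f g : arrow C) :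
  f = g -> forall X : C, X ◁ f = X ◁ g.
Proof. by move=> ->. Qed.

Lemma rwh_congr (F : fieldType) (C : strict_tensor_cat F) (f g : arrow C) :
  f = g -> forall X : C, f ▷ X = g ▷ X.
Proof. by move=> ->. Qed.

(** Normal form: composites are right associated, whiskers distributed over
    the factors and nested as [X ◁ (Y ◁ (f ▷ Z))]. *)
Ltac side := by rewrite /= ?asrc_comp ?atgt_comp /= ?tensA ?tens1x ?tensx1.
Ltac layers_in e :=
  rewrite ?(lwh_tens, rwh_tens, lrwh, lwh_unit, rwh_unit) in e;
  repeat first [ rewrite lwh_comp in e; [|side] | rewrite rwh_comp in e; [|side] ];
  rewrite ?(lwh_tens, rwh_tens, lrwh, lwh_unit, rwh_unit) -?acompA in e.
Ltac layers :=
  rewrite ?(lwh_tens, rwh_tens, lrwh, lwh_unit, rwh_unit);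
  repeat first [ rewrite lwh_comp; [|side] | rewrite rwh_comp; [|side] ];
  rewrite ?(lwh_tens, rwh_tens, lrwh, lwh_unit, rwh_unit) -?acompA.
Ltac crw_with e :=
  layers_in e;
  first [ rewrite e | rewrite (acomp_reassoc e) | rewrite (acomp_reassoc3 e)
        | rewrite (acomp_reassoc5 e) ];
  rewrite -?acompA; clear e.
Tactic Notation "crw" constr(H) :=
  let e := fresh "e" in have e := H; crw_with e.
Tactic Notation "crw" "-" constr(H) :=
  let e := fresh "e" in have e := esym H; crw_with e.
Tactic Notation "crwl" constr(X) constr(H) :=
  let e := fresh "e" in have e := lwh_congr H X; crw_with e.
Tactic Notation "crwl" "-" constr(X) constr(H) :=
  let e := fresh "e" in have e := lwh_congr (esym H) X; crw_with e.
Tactic Notation "crwr" constr(X) constr(H) :=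
  let e := fresh "e" in have e := rwh_congr H X; crw_with e.
Tactic Notation "crwr" "-" constr(X) constr(H) :=
  let e := fresh "e" in have e := rwh_congr (esym H) X; crw_with e.

Section HalfBraiding.
Variables (F : fieldType) (C : BTC F) (G : C).
Variables (D : Mor G (G ⊗ G)) (ep : Mor G tunit).

(** The map of cofree Γ-comodules determined by s; it turns composition in $\mathcal
    C\rtimes_0\mathcal S$ into composition in $\mathcal C$. *)
Definition hat X Y (s : Mor (G ⊗ X) Y) : Mor (G ⊗ X) (G ⊗ Y) :=
  (idmor G ⊠ s) ∘ asci G G X ∘ (D ⊠ idmor X).

Lemma hatE X Y (s : Mor (G ⊗ X) Y) : ⟨hat s⟩ = (G ◁ ⟨s⟩) • (⟨D⟩ ▷ X).
Proof. by rewrite /hat acompE acomp_eqmr. Qed.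

(** Common properties of the braiding [br G X] and of the inverse braiding [bri X G], which
    satisfies [hb_self] because Γ is symmetric with itself. *)
Record half_braiding (J : forall X : C, Mor (G ⊗ X) (X ⊗ G)) : Prop := {
  hb_nat : forall X Y (s : Mor X Y), ⟨J Y⟩ • (G ◁ ⟨s⟩) = (⟨s⟩ ▷ G) • ⟨J X⟩;
  hb_tens : forall X Y, ⟨J (X ⊗ Y)⟩ = (X ◁ ⟨J Y⟩) • (⟨J X⟩ ▷ Y);
  hb_end : forall X (b : Mor G G), ⟨J X⟩ • (⟨b⟩ ▷ X) = (X ◁ ⟨b⟩) • ⟨J X⟩;
  hb_comul : forall X,
    (X ◁ ⟨D⟩) • ⟨J X⟩ = (⟨J X⟩ ▷ G) • (G ◁ ⟨J X⟩) • (⟨D⟩ ▷ X);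
  hb_counit : forall X, (X ◁ ⟨ep⟩) • ⟨J X⟩ = ⟨ep⟩ ▷ X;
  hb_self : J G = br G G }.

Hypothesis coassoc : (⟨D⟩ ▷ G) • ⟨D⟩ = (G ◁ ⟨D⟩) • ⟨D⟩.
Hypothesis counit : (⟨ep⟩ ▷ G) • ⟨D⟩ = ⟨idmor G⟩.
Hypothesis cocomm : ⟨br G G⟩ • ⟨D⟩ = ⟨D⟩.

Lemma hat_coact X Y (s : Mor (G ⊗ X) Y) :
  (⟨D⟩ ▷ Y) • ⟨hat s⟩ = (G ◁ ⟨hat s⟩) • (⟨D⟩ ▷ X).
Proof.
rewrite hatE; layers.
crwr X (esym coassoc).
by crw (wh_exch D s).
Qed.

Lemma hat_comp X Y Z (t : Mor (G ⊗ Y) Z) (s : Mor (G ⊗ X) Y) :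
  hat (t ∘ hat s) = hat t ∘ hat s.
Proof.
apply: Arrow_inj; rewrite acompE (hatE (t ∘ _)) acompE; layers.
by crw - (hat_coact s); rewrite (hatE t) -acompA.
Qed.

Lemma counit_hat X Y (s : Mor (G ⊗ X) Y) : (⟨ep⟩ ▷ Y) • ⟨hat s⟩ = ⟨s⟩.
Proof.
rewrite hatE; crw - (wh_exch ep s); crwr X counit.
by rewrite rwh_id acomp_idr.
Qed.

Section OneHalfBraiding.
Variable J : forall X : C, Mor (G ⊗ X) (X ⊗ G).
Hypothesis hJ : half_braiding J.

Lemma hb_hat X Y (s : Mor (G ⊗ X) Y) :
  ⟨J Y⟩ • ⟨hat s⟩ = (⟨s⟩ ▷ G) • (G ◁ ⟨J X⟩) • (⟨D⟩ ▷ X).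
Proof.
rewrite hatE; crw (hb_nat hJ s); rewrite hb_tens // -!acompA hb_self //.
by crwr X cocomm.
Qed.

(** Naturality of J with respect to the morphism K, a Yang-Baxter move; cocommutativity absorbs the
    crossing of the two copies of Γ created by [D]. *)
Lemma hb_swap X (K : Mor (G ⊗ X) (X ⊗ G)) :
  (⟨K⟩ ▷ G) • (G ◁ ⟨J X⟩) • (⟨D⟩ ▷ X)
  = (X ◁ ⟨br G G⟩) • (⟨J X⟩ ▷ G) • (G ◁ ⟨K⟩) • (⟨D⟩ ▷ X).
Proof.
have e := hb_nat hJ K; rewrite !hb_tens // hb_self // -!acompA in e.
rewrite (acompA _ (⟨J X⟩ ▷ G)) (acompA _ (G ◁ ⟨K⟩)) -(acompA _ _ (G ◁ ⟨K⟩)) e.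
by rewrite -!acompA; crwr X cocomm.
Qed.

End OneHalfBraiding.
Section TwoHalfBraidings.
Variables J K : forall X : C, Mor (G ⊗ X) (X ⊗ G).
Hypotheses (hJ : half_braiding J) (hK : half_braiding K).

(** For K the inverse braiding and J the braiding, [graded b s] says that the
    inverse monodromy acts on the image of [hat s] as b. *)
Definition graded (b : Mor G G) X Y (s : Mor (G ⊗ X) Y) : Prop :=
  ⟨K Y⟩ • ⟨hat s⟩ = (Y ◁ ⟨b⟩) • ⟨J Y⟩ • ⟨hat s⟩.

Lemma graded_compr b X Y Z (s : Mor (G ⊗ X) Y) (t : Mor (G ⊗ Z) X) :
  graded b s -> graded b (s ∘ hat t).
Proof. by rewrite /graded hat_comp acompE => h; crw h. Qed.

Lemma graded_compl b X Y Z (s : Mor (G ⊗ X) Y) (w : Mor Y Z) :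
  graded b s -> graded b (w ∘ s).
Proof.
have e : ⟨hat (w ∘ s)⟩ = (G ◁ ⟨w⟩) • ⟨hat s⟩.
  by rewrite !hatE acompE; layers.
rewrite /graded e => h; crw (hb_nat hK w); crw (hb_nat hJ w).
by rewrite h; crw (wh_exch w b).
Qed.

(** The tensor product of the Galois extension. *)
Definition gtens X X' Y Y' (s : Mor (G ⊗ X) X') (t : Mor (G ⊗ Y) Y') :
    Mor (G ⊗ (X ⊗ Y)) (X' ⊗ Y') :=
  (idmor X' ⊠ t) ∘ asci X' G Y ∘ ((J X' ∘ hat s) ⊠ idmor Y) ∘ asc G X Y.

Lemma gtensE X X' Y Y' (s : Mor (G ⊗ X) X') (t : Mor (G ⊗ Y) Y') :
  ⟨gtens s t⟩ = (X' ◁ ⟨t⟩) • (⟨J X'⟩ ▷ Y) • (⟨hat s⟩ ▷ Y).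
Proof. by rewrite /gtens acomp_eqmr acompE acomp_eqmr rwhE acompE; layers. Qed.

Lemma hat_gtens (L : forall X : C, Mor (G ⊗ X) (X ⊗ G)) X X' Y Y'
    (s : Mor (G ⊗ X) X') (t : Mor (G ⊗ Y) Y') :
  (⟨L X'⟩ ▷ Y') • ⟨hat (gtens s t)⟩ =
  (X' ◁ G ◁ ⟨t⟩) • (⟨L X'⟩ ▷ G ▷ Y) • (G ◁ ⟨J X'⟩ ▷ Y) • (G ◁ ⟨hat s⟩ ▷ Y)
   • (⟨D⟩ ▷ X ▷ Y).
Proof.
rewrite (hatE (gtens s t)) gtensE; layers.
by crw - (wh_exch (L X') t).
Qed.

(** Crossing X' ⊗ Y' means crossing X' and then Y'. The first crossing produces g, which passes the
    second by [hb_end] and so ends up to the left of h. *)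
Lemma graded_gtens g h X X' Y Y' (s : Mor (G ⊗ X) X') (t : Mor (G ⊗ Y) Y') :
  graded g s -> graded h t -> graded (g ∘ h) (gtens s t).
Proof.
move=> gs gt.
have eJ : (⟨J X'⟩ ▷ Y') • ⟨hat (gtens s t)⟩
    = (X' ◁ ⟨hat t⟩) • (⟨J X'⟩ ▷ Y) • (⟨hat s⟩ ▷ Y).
  rewrite hat_gtens; crwr Y (esym (hat_coact s)).
  by crwr Y (esym (hb_comul hJ X')); rewrite (hatE t); layers.
have eK : (⟨K X'⟩ ▷ Y') • ⟨hat (gtens s t)⟩
    = (X' ◁ ⟨g⟩ ▷ Y') • (⟨J X'⟩ ▷ Y') • ⟨hat (gtens s t)⟩.
  rewrite hat_gtens; crwr Y (esym (hat_coact s)).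
  (* [J X'] separates [K X'] from [hat s]; the swap makes them adjacent, so that the grading [gs]
     applies. *)
  crwr Y (hb_swap hJ (K X')); crwr Y (hat_coact s).
  rewrite eJ; crwr Y (lwh_congr gs G); crwr Y (esym (wh_exch (J X') g)).
  crwr Y (esym (hat_coact s)).
  crwr Y (esym (hb_comul hJ X')).
  have e := hb_nat hJ g; rewrite !(hb_self hJ) in e.
  crwl X' (rwh_congr e Y); crwl X' (rwh_congr cocomm Y).
  by crwl X' (wh_exch g t); rewrite (hatE t); layers.
rewrite /graded !hb_tens // -!acompA; rewrite eK eJ.
crwl X' (hb_end hK Y' g); crwl X' gt.
by rewrite acompE; layers.
Qed.

Variable (m : Mor (G ⊗ G) G) (et : Mor tunit G).

(** Twice crossing X with the two copies of Γ, once by each half-braiding. *)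
Definition cross2 X : Mor (G ⊗ X) (X ⊗ (G ⊗ G)) :=
  asci X G G ∘ (J X ⊠ idmor G) ∘ asc G X G ∘ (idmor G ⊠ K X) ∘ asci G G X
    ∘ (D ⊠ idmor X).

Lemma cross2E X :
  ⟨cross2 X⟩ = (⟨J X⟩ ▷ G) • (G ◁ ⟨K X⟩) • (⟨D⟩ ▷ X).
Proof.
rewrite /cross2 acompE acomp_eqmr acompE acomp_eqmr acomp_eqml.
by rewrite -acompA.
Qed.

(** For b in G and up to the factor |G|, the component π_b of the inverse
    monodromy. *)
Definition homcomp (b : Mor G G) X : Mor (G ⊗ X) X :=
  eqm (tensx1 X) ∘ (idmor X ⊠ (ep ∘ m ∘ (b ⊠ idmor G))) ∘ cross2 X.

Lemma homcompE b X :
  ⟨homcomp b X⟩ = (X ◁ ⟨ep⟩) • (X ◁ ⟨m⟩) • (X ◁ ⟨b⟩ ▷ G) • ⟨cross2 X⟩.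
Proof.
rewrite /homcomp acompE acomp_eqml lwhE 2!acompE rwhE.
by layers.
Qed.

Hypothesis cross_frob : ((⟨ep⟩ • ⟨m⟩) ▷ G) • (G ◁ ⟨D⟩) = ⟨m⟩.
Hypothesis unitm : ⟨m⟩ • (⟨et⟩ ▷ G) = ⟨idmor G⟩.

Lemma cross2_comul (L : forall X : C, Mor (G ⊗ X) (X ⊗ G)) X :
  (⟨cross2 X⟩ ▷ G) • (G ◁ ⟨L X⟩) • (⟨D⟩ ▷ X) =
  (⟨J X⟩ ▷ G ▷ G) • (G ◁ ⟨K X⟩ ▷ G) • (G ◁ G ◁ ⟨L X⟩) • (G ◁ ⟨D⟩ ▷ X) • (⟨D⟩ ▷ X).
Proof.
rewrite cross2E; layers; crw - (wh_exch D (L X)).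
by crwr X coassoc.
Qed.

(** The crossings met here are J, K, K. The two by K merge into a single crossing followed by [D],
    and the Frobenius relation absorbs [ep] and [m]. *)
Lemma homcomp_K b X :
  ⟨K X⟩ • ⟨hat (homcomp b X)⟩ = (X ◁ (⟨m⟩ • (⟨b⟩ ▷ G))) • ⟨cross2 X⟩.
Proof.
rewrite hb_hat // homcompE; layers; rewrite cross2_comul.
crwl G (esym (hb_comul hK X)).
crw - (wh_exch (J X) D).
crwl X (esym (wh_exch b D)); crwl X cross_frob.
by rewrite cross2E.
Qed.

(** The crossings are now J, K, J, reordered by [hb_swap] so that the two by J merge. The hypothesis
    on b is the identity then left on Γ ⊗ Γ; translations satisfy it. With [homcomp_K] it shows that
    [homcomp b X] is graded by b. *)
Lemma homcomp_J b X :
  ⟨b⟩ • ((⟨ep⟩ • ⟨m⟩ • (⟨b⟩ ▷ G)) ▷ G) • (G ◁ ⟨br G G⟩) • (⟨D⟩ ▷ G)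
    = ⟨m⟩ • (⟨b⟩ ▷ G) ->
  (X ◁ ⟨b⟩) • ⟨J X⟩ • ⟨hat (homcomp b X)⟩ = (X ◁ (⟨m⟩ • (⟨b⟩ ▷ G))) • ⟨cross2 X⟩.
Proof.
move=> hb; rewrite hb_hat // homcompE; layers; rewrite cross2_comul.
crwl G (hb_swap hJ (K X)).
crwr X (esym coassoc); crw (wh_exch D (K X)).
crw - (wh_exch (J X) (br G G)); crwr G (esym (hb_comul hJ X)).
rewrite -cross2E; have /= e := congr1 (fun a => a • ⟨cross2 X⟩) (lwh_congr hb X).
by layers_in e.
Qed.

(** Meant for $\sum_k\rho_k=|G|\,\eta\circ\varepsilon$: the components add up to $|G|$ times the
    identity of X in $\mathcal C\rtimes_0\mathcal S$. *)
Lemma homcomp_counit X :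
  ⟨homcomp (et ∘ ep) X⟩ = ⟨ep⟩ ▷ X.
Proof.
rewrite homcompE cross2E acompE; layers.
crwl X unitm; rewrite lwh_id acomp_idl; [|side].
crwr G (hb_counit hJ X).
crw - (wh_exch ep (K X)); crwr X counit.
by rewrite rwh_id acomp_idr // (hb_counit hK).
Qed.

End TwoHalfBraidings.
End HalfBraiding.

(** * The braiding and its inverse as half-braidings *)

Section Braided.
Variables (F : fieldType) (C : BTC F).
Implicit Types X Y Z : C.

Lemma bri_nat X X' Y Y' (s : Mor X X') (t : Mor Y Y') :
  bri X' Y' ∘ (t ⊠ s) = (s ⊠ t) ∘ bri X Y.
Proof.
rewrite -[LHS]comp_idr -(briK X Y) Defs.compA -(Defs.compA _ (t ⊠ s)) -br_nat.
by rewrite Defs.compA brK comp_idl.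
Qed.

Lemma br_inv_uniq X Y (s : Mor (Y ⊗ X) (X ⊗ Y)) : s ∘ br X Y = idmor _ -> s = bri X Y.
Proof. by move=> h; rewrite -[s]comp_idr -(briK X Y) Defs.compA h comp_idl. Qed.

Lemma acomp_inv_uniq (W : C) (f g h : arrow C) :
  f • g = ⟨idmor W⟩ -> g • h = ⟨idmor (atgt g)⟩ -> asrc f = atgt g ->
  atgt h = W -> f = h.
Proof.
move=> fg gh e e'.
by rewrite -[f](acomp_idr e) -gh acompA fg acomp_idl.
Qed.

Lemma arrow_brK X Y : ⟨bri X Y⟩ • ⟨br X Y⟩ = ⟨idmor (X ⊗ Y)⟩.
Proof. by rewrite -acompE brK. Qed.

Lemma arrow_briK X Y : ⟨br X Y⟩ • ⟨bri X Y⟩ = ⟨idmor (Y ⊗ X)⟩.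
Proof. by rewrite -acompE briK. Qed.

Lemma arrow_br_nat X X' Y Y' (s : Mor X X') (t : Mor Y Y') :
  ⟨br X' Y'⟩ • ⟨s ⊠ t⟩ = ⟨t ⊠ s⟩ • ⟨br X Y⟩.
Proof. by rewrite -!acompE br_nat. Qed.

Lemma arrow_bri_nat X X' Y Y' (s : Mor X X') (t : Mor Y Y') :
  ⟨bri X' Y'⟩ • ⟨t ⊠ s⟩ = ⟨s ⊠ t⟩ • ⟨bri X Y⟩.
Proof. by rewrite -!acompE bri_nat. Qed.

Lemma arrow_br_tensr X Y Z : ⟨br X (Y ⊗ Z)⟩ = (Y ◁ ⟨br X Z⟩) • (⟨br X Y⟩ ▷ Z).
Proof. by rewrite br_tensr acomp_eqmr acompE acomp_eqmr acomp_eqml. Qed.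

Lemma arrow_br_tensl X Y Z : ⟨br (X ⊗ Y) Z⟩ = (⟨br X Z⟩ ▷ Y) • (X ◁ ⟨br Y Z⟩).
Proof. by rewrite br_tensl acomp_eqmr acompE acomp_eqmr acomp_eqml. Qed.

Lemma arrow_bri_tensr X Y Z : ⟨bri X (Y ⊗ Z)⟩ = (⟨bri X Y⟩ ▷ Z) • (Y ◁ ⟨bri X Z⟩).
Proof.
symmetry; apply: (@acomp_inv_uniq (X ⊗ (Y ⊗ Z)) _ ⟨br X (Y ⊗ Z)⟩).
- rewrite arrow_br_tensr; layers.
  crwl Y (arrow_brK X Z); rewrite lwh_id acomp_idl; [|side].
  by crwr Z (arrow_brK X Y); rewrite rwh_id tensA.
- exact: arrow_briK.
- by side.
- by side.
Qed.

Lemma arrow_bri_tensl X Y Z : ⟨bri (X ⊗ Y) Z⟩ = (X ◁ ⟨bri Y Z⟩) • (⟨bri X Z⟩ ▷ Y).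
Proof.
symmetry; apply: (@acomp_inv_uniq (X ⊗ Y ⊗ Z) _ ⟨br (X ⊗ Y) Z⟩).
- rewrite arrow_br_tensl; layers.
  crwr Y (arrow_brK X Z); rewrite rwh_id acomp_idl; [|side].
  by crwl X (arrow_brK Y Z); rewrite lwh_id tensA.
- exact: arrow_briK.
- by side.
- by side.
Qed.

(** The hexagon for 1 ⊗ 1 = 1 makes this braiding idempotent, and an invertible idempotent is the
    identity. *)
Lemma br_unitr X : ⟨br X tunit⟩ = ⟨idmor X⟩.
Proof.
have e := arrow_br_tensr X tunit tunit.
have h : ⟨br X (tunit ⊗ tunit)⟩ = ⟨br X tunit⟩ by rewrite tens1x.
rewrite h lwh_unit rwh_unit in e.
have := congr1 (acomp ⟨bri X tunit⟩) e.
rewrite acompA arrow_brK acomp_idl; last by rewrite /= tens1x tensx1.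
by move=> <-; rewrite tensx1.
Qed.

Lemma br_unitl X : ⟨br tunit X⟩ = ⟨idmor X⟩.
Proof.
have e := arrow_br_tensl tunit tunit X.
have h : ⟨br (tunit ⊗ tunit) X⟩ = ⟨br tunit X⟩ by rewrite tens1x.
rewrite h lwh_unit rwh_unit in e.
have := congr1 (acomp ⟨bri tunit X⟩) e.
rewrite acompA arrow_brK acomp_idl; last by rewrite /= tens1x tensx1.
by move=> <-; rewrite tens1x.
Qed.

Lemma bri_unitr X : ⟨bri X tunit⟩ = ⟨idmor X⟩.
Proof.
have := arrow_brK X tunit; rewrite br_unitr acomp_idr; last by rewrite /= tens1x.
by move=> ->; rewrite tensx1.
Qed.

Section Center.
Variables (G : C) (D : Mor G (G ⊗ G)) (ep : Mor G tunit).
Hypothesis symG : br G G ∘ br G G = idmor _.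

Lemma half_braiding_br : half_braiding D ep (fun X => br G X).
Proof.
split=> //.
- by move=> X Y s; rewrite -lwhE arrow_br_nat.
- by move=> X Y; rewrite arrow_br_tensr.
- by move=> X b; rewrite -rwhE arrow_br_nat.
- by move=> X; rewrite -lwhE -arrow_br_nat arrow_br_tensl acompA.
- by move=> X; rewrite -lwhE -arrow_br_nat br_unitl acomp_idl //= tens1x.
Qed.

Lemma half_braiding_bri : half_braiding D ep (fun X => bri X G).
Proof.
split=> //.
- by move=> X Y s; rewrite -lwhE arrow_bri_nat.
- by move=> X Y; rewrite arrow_bri_tensl.
- by move=> X b; rewrite -rwhE arrow_bri_nat.
- by move=> X; rewrite -lwhE -arrow_bri_nat arrow_bri_tensr acompA.
- by move=> X; rewrite -lwhE -arrow_bri_nat bri_unitr acomp_idl //= tens1x.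
- by rewrite (br_inv_uniq symG).
Qed.

End Center.
End Braided.

(** * Partial traces and the grade of an object *)

Section ZeroArrows.
Variables (F : fieldType) (C : strict_tensor_cat F).
Implicit Types X Y Z : C.

Lemma Arrow0 X X' Y Y' : X = X' -> Y = Y' -> ⟨0 : Mor X Y⟩ = ⟨0 : Mor X' Y'⟩.
Proof. by move=> -> ->. Qed.

Lemma acomp0r f X Y : f • ⟨0 : Mor X Y⟩ = ⟨0 : Mor X (atgt f)⟩.
Proof.
case: f => Y' Z t; have [e|n] := pselect (Y = Y'); last by rewrite acomp_mismatch.
by case: Y' / e t => t; rewrite -acompE compm0.
Qed.

Lemma acomp0l f X Y : ⟨0 : Mor X Y⟩ • f = ⟨0 : Mor (asrc f) Y⟩.
Proof.
case: f => Z X' t; have [e|n] := pselect (X' = X); last by rewrite acomp_mismatch.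
by case: X / e; rewrite -acompE comp0m.
Qed.

Lemma rwh0 W X Y : ⟨0 : Mor X Y⟩ ▷ W = ⟨0 : Mor (X ⊗ W) (Y ⊗ W)⟩.
Proof. by rewrite /rwh /= tens0m. Qed.

Definition ascale (a : F) (f : arrow C) := ⟨a *: amor f⟩.

Lemma acompZr a g f : g • ascale a f = ascale a (g • f).
Proof.
case: f g => X Y s [Y' Z t]; have [e|n] := pselect (Y = Y').
  by case: Y' / e t => t; rewrite -acompE /ascale /= -acompE compZr.
by rewrite /ascale !acomp_mismatch //= scaler0.
Qed.

Lemma acompZl a g f : ascale a g • f = ascale a (g • f).
Proof.
case: f g => X Y s [Y' Z t]; have [e|n] := pselect (Y = Y').
  by case: Y' / e t => t; rewrite -acompE /ascale /= -acompE compZl.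
by rewrite /ascale !acomp_mismatch //= scaler0.
Qed.

Lemma lwh_scale X a f : X ◁ ascale a f = ascale a (X ◁ f).
Proof. by rewrite /lwh /ascale /= tensmZr. Qed.

Lemma rwh_scale X a f : ascale a f ▷ X = ascale a (f ▷ X).
Proof. by rewrite /rwh /ascale /= tensmZl. Qed.

End ZeroArrows.

Section Scal.
Variables (F : fieldType) (C : BTC F).

Lemma scal_id : scal (idmor (tunit : C)) = 1.
Proof.
have fr : free [tuple idmor (tunit : C)].
  by rewrite /= seq1_free; apply/eqP; case: (btc_one C).
exact: coord_free ord0 ord0 fr.
Qed.

Lemma scalZ a (s : Mor (tunit : C) tunit) : scal (a *: s) = a * scal s.
Proof. exact: linearZ. Qed.

Lemma scalD (s t : Mor (tunit : C) tunit) : scal (s + t) = scal s + scal t.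
Proof. exact: linearD. Qed.

Lemma scalK (s : Mor (tunit : C) tunit) : s = scal s *: idmor tunit.
Proof.
by have [n0 /(_ s)[a ->]] := btc_one C; rewrite scalZ scal_id mulr1.
Qed.

Lemma scal_neq0 (s : Mor (tunit : C) tunit) : s <> 0 -> scal s != 0.
Proof. by move=> s0; apply/eqP => e; apply: s0; rewrite [s]scalK e scale0r. Qed.

End Scal.

Section Trace.
Variables (F : fieldType) (C : BTC F) (A : frob_data C).
Local Notation G := (Gam A).
Local Notation D := (acomul A).
Local Notation ep := (acnt A).
Local Notation et := (aunt A).
Local Notation hat := (hat D).

(** The partial trace over X of s, at the unit of Γ the trace of (X, s). *)
Definition ptr X (s : Mor (G ⊗ X) X) : Mor G tunit :=
  evbar X ∘ (s ⊠ idmor (dual X)) ∘ asc G X (dual X) ∘ (idmor G ⊠ coev X)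
    ∘ eqm (esym (tensx1 G)).

Lemma ptrE X (s : Mor (G ⊗ X) X) :
  ⟨ptr s⟩ = ⟨evbar X⟩ • (⟨s⟩ ▷ dual X) • (G ◁ ⟨coev X⟩).
Proof. by rewrite /ptr acomp_eqmr acompE acomp_eqmr acompE -acompA. Qed.

Lemma ptr_unit X (s : Mor (G ⊗ X) X) :
  ⟨ptr s ∘ et⟩ = ⟨evbar X ∘ (s ⊠ idmor (dual X)) ∘ asc G X (dual X)
          ∘ (et ⊠ coev X) ∘ eqm (esym (tens1x tunit))⟩.
Proof.
rewrite [in LHS]acompE ptrE acomp_eqmr acompE (tensE et) acomp_eqmr acompE rwhE; layers.
by crw - (wh_exch et (coev X)).
Qed.

Lemma gdimE (P : gobj A) : gdim P = scal (ptr (gidem P) ∘ et).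
Proof. by rewrite /gdim -(Arrow_inj (ptr_unit _)). Qed.

Hypothesis counit_simple : forall s : Mor G tunit, exists a : F, s = a *: ep.
Hypothesis counit_unit : ep ∘ et = idmor tunit.
Hypothesis counitr : (G ◁ ⟨ep⟩) • ⟨D⟩ = ⟨idmor G⟩.
Hypothesis counit : (⟨ep⟩ ▷ G) • ⟨D⟩ = ⟨idmor G⟩.

(** Every morphism from Γ to 1 is a multiple of ε; the factor is read off at η. *)
Lemma ptr_counit X (s : Mor (G ⊗ X) X) : ptr s = scal (ptr s ∘ et) *: ep.
Proof.
by have [a ->] := counit_simple (ptr s); rewrite compZl counit_unit scalZ scal_id mulr1.
Qed.

(** Tracing out the second factor leaves a multiple of ε, which passes the half-braiding and turns
    [hat s] back into s. *)
Lemma ptr_gtens (J : forall X : C, Mor (G ⊗ X) (X ⊗ G)) X X' Y a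
    (s : Mor (G ⊗ X) X') (t : Mor (G ⊗ Y) Y) :
  half_braiding D ep J -> ptr t = a *: ep ->
  (X' ◁ ⟨evbar Y⟩) • (⟨gtens D J s t⟩ ▷ dual Y) • (G ◁ X ◁ ⟨coev Y⟩) =
  ascale a ⟨s⟩.
Proof.
move=> hJ ta; rewrite gtensE; layers.
crw - (wh_exch (hat s) (coev Y)); crw - (wh_exch (J X') (coev Y)).
have e : (X' ◁ ⟨evbar Y⟩) • (X' ◁ ⟨t⟩ ▷ dual Y) • (X' ◁ G ◁ ⟨coev Y⟩) = X' ◁ ⟨ptr t⟩.
  by rewrite ptrE; layers.
crw e; rewrite ta -/(ascale _ ⟨ep⟩) lwh_scale acompZl.
by crw (hb_counit hJ X'); rewrite counit_hat.
Qed.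

Lemma gtens_neq0 (J : forall X : C, Mor (G ⊗ X) (X ⊗ G)) X X' Y a
    (s : Mor (G ⊗ X) X') (t : Mor (G ⊗ Y) Y) : half_braiding D ep J ->
  s <> 0 -> ptr t = a *: ep -> a != 0 -> gtens D J s t <> 0.
Proof.
move=> hJ s0 ta a0 st0; apply: s0.
have := ptr_gtens s hJ ta; rewrite st0 rwh0 acomp0l acomp0r /ascale.
rewrite (@Arrow0 _ _ _ (G ⊗ X) _ X'); [|side|side] => /Arrow_inj /esym /eqP.
by rewrite scaler_eq0 (negPf a0) => /eqP.
Qed.

(** Used with b = id for an idempotent graded by b', and with b = b' the projection onto $\Gamma_0$,
    where the monodromy is trivial. Once the monodromy is removed, the partial trace and the counit
    law give the dimension that the grade divides by. *)
Lemma grade_eq (P : gobj A) (b b' : Mor G G) :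
  (⟨b⟩ ▷ gcar P) • ⟨bri G (gcar P)⟩ • ⟨bri (gcar P) G⟩ • ⟨hat (gidem P)⟩
    = (⟨b'⟩ ▷ gcar P) • ⟨hat (gidem P)⟩ ->
  gdim P != 0 -> b ∘ grade P = b'.
Proof.
case: P => X p hp /= hb d0; rewrite /grade.
set d := gdim _; set g := (X in d^-1 *: X); rewrite -/d in d0.
suff e : ⟨b ∘ g⟩ = ascale d ⟨b'⟩.
  by rewrite compZr (Arrow_inj e) /= scalerA mulVf // scale1r.
have -> : ⟨b ∘ g⟩ = ⟨b⟩ • (G ◁ ⟨evbar X⟩) • (⟨bri G X⟩ ▷ dual X) • (⟨bri X G⟩ ▷ dual X)
  • (G ◁ ⟨p⟩ ▷ dual X) • (⟨D⟩ ▷ X ▷ dual X) • (G ◁ ⟨coev X⟩).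
  rewrite acompE /g acomp_eqmr /= acompE (tensE D) acomp_eqmr acompE lwhE rwhE.
  rewrite acomp_eqmr acompE rwhE acomp_eqmr.
  rewrite acomp_eqml lwhE (acompE (bri G X)).
  by layers.
rewrite hatE in hb.
crw - (wh_exch b (evbar X)); crwr (dual X) hb.
crw - (wh_exch D (coev X)); crw (wh_exch b' (evbar X)).
have -> : (G ◁ ⟨evbar X⟩) • (G ◁ ⟨p⟩ ▷ dual X) • (G ◁ G ◁ ⟨coev X⟩) • ⟨D⟩
   = (G ◁ ⟨ptr p⟩) • ⟨D⟩ by rewrite ptrE; layers.
rewrite ptr_counit -/(ascale _ ⟨ep⟩) lwh_scale acompZl counitr acompZr.
by rewrite acomp_idr // /d gdimE.
Qed.

End Trace.

(** * Simple idempotents of regular algebras *)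

Section RegularAlgebra.
Variables (F : closedFieldType) (V : vectType F) (mul : V -> V -> V).
Local Notation "x · y" := (mul x y) (at level 40, left associativity).
Hypothesis mulA : forall x y z, x · (y · z) = x · y · z.
Hypothesis mul_linl : forall z, linear (fun x => x · z).
Hypothesis mul_linr : forall z, linear (fun x => z · x).

Let mulDl x y z : (x + y) · z = x · z + y · z.
Proof. by have := mul_linl z 1 x y; rewrite !scale1r. Qed.
Let mulDr x y z : z · (x + y) = z · x + z · y.
Proof. by have := mul_linr z 1 x y; rewrite !scale1r. Qed.
Let mul0l x : 0 · x = 0.
Proof. by apply: (addrI (0 · x)); rewrite -mulDl !addr0. Qed.
Let mul0r x : x · 0 = 0.
Proof. by apply: (addrI (x · 0)); rewrite -mulDr !addr0. Qed.
Let mulZl a x z : (a *: x) · z = a *: (x · z).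
Proof. by have := mul_linl z a x 0; rewrite !addr0 mul0l addr0. Qed.
Let mulZr a x z : z · (a *: x) = a *: (z · x).
Proof. by have := mul_linr z a x 0; rewrite !addr0 mul0r addr0. Qed.
Let mulNl x z : (- x) · z = - (x · z).
Proof. by rewrite -scaleN1r mulZl scaleN1r. Qed.
Let mulNr x z : z · (- x) = - (z · x).
Proof. by rewrite -scaleN1r mulZr scaleN1r. Qed.
Let mulE := (mulDl, mulDr, mulNl, mulNr, mulZl, mulZr, mul0l, mul0r, mulA).

Definition corner_map (e x : V) := e · x · e.

Lemma corner_map_linear e : linear (corner_map e).
Proof. by move=> a x y; rewrite /corner_map !mulE. Qed.

HB.instance Definition _ e :=
  GRing.isLinear.Build F V V _ (corner_map e) (corner_map_linear e).

Definition corner e : {vspace V} := limg (linfun (corner_map e)).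

Lemma mem_corner e x : e · e = e -> reflect (e · x · e = x) (x \in corner e).
Proof.
move=> ee; apply: (iffP memv_imgP) => [[b _ ->]|<-].
  by rewrite lfunE /= /corner_map !mulE ee -!mulA ee.
by exists x; rewrite ?memvf // lfunE.
Qed.

(** Right multiplication by x acts on the corner of e, which is finite-dimensional and nonzero since
    it contains e; F is algebraically closed. *)
Lemma corner_eigenvector e x : e · e = e -> e <> 0 -> e · x · e = x ->
  exists (a : F) (w : V), [/\ e · w · e = w, w <> 0 & w · x = a *: w].
Proof.
move=> ee e0 ex; pose X := vbasis (corner e).
have dpos : (0 < \dim (corner e))%N.
  rewrite lt0n dimv_eq0; apply: contra_notN e0 => /eqP c0.
  by apply/eqP; rewrite -memv0 -c0; apply/(mem_corner _ ee); rewrite !ee.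
have mX i : X`_i \in corner e.
  have [lt|ge] := ltnP i (size X); last by rewrite nth_default ?mem0v.
  exact/vbasis_mem/mem_nth.
have mXx i : X`_i · x \in corner e.
  have /(mem_corner _ ee) h := mX i.
  by apply/(mem_corner _ ee); rewrite -h -ex !mulE ee -!(mulA _ e e) !ee.
pose M := \matrix_(i < \dim (corner e), j < \dim (corner e)) coord X j (X`_i · x).
have [a] : exists a, root (char_poly M) a.
  by apply/closed_rootP; rewrite size_char_poly eqSS -lt0n.
rewrite -eigenvalue_root_char => /eigenvalueP [v vM v0].
exists a, (\sum_i v 0 i *: X`_i).
have Xfree : free X := basis_free (vbasisP _).
split.
- by apply/(mem_corner _ ee)/memv_suml => i _; apply: memvZ.
- move=> w0; case/negP: v0; apply/eqP/rowP => i.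
  by rewrite mxE; exact: (freeP Xfree (v 0) w0 i).
rewrite (big_morph (fun w => w · x) (id1 := 0) (op1 := +%R)) //.
rewrite scaler_sumr.
have e1 i : (v 0 i *: X`_i) · x = \sum_j (v 0 i * M i j) *: X`_j.
  rewrite mulZl {1}(coord_vbasis (mXx i)) scaler_sumr.
  by apply: eq_bigr => j _; rewrite scalerA mxE.
under eq_bigr do rewrite e1.
rewrite exchange_big; apply: eq_bigr => j _ /=.
rewrite -scaler_suml scalerA; congr (_ *: _).
by have := congr1 (fun u : 'rV__ => u 0 j) vM; rewrite !mxE.
Qed.

Hypothesis regular : forall x, exists y, x · y · x = x.

(** Shifting x by an eigenvalue gives y nonzero with w · y = 0 for an eigenvector w. If z is a
    generalized inverse of y, then y · z · e is idempotent, and it differs from e because w kills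
    it. *)
Lemma corner_idempotent e x : e · e = e -> e · x · e = x ->
  (forall a, x <> a *: e) ->
  exists f, [/\ f · f = f, e · f · e = f, f <> 0 & f <> e].
Proof.
move=> ee ex nx.
have e0 : e <> 0 by move=> e0; apply: (nx 0); rewrite -ex e0 !mul0r scaler0.
have [a [w [ew w0 wx]]] := corner_eigenvector ee e0 ex.
pose y := x - a *: e.
have ey : e · y = y by rewrite /y !mulE ee -ex !mulE ee.
have ye : y · e = y by rewrite /y !mulE ee -ex -!mulA ee.
have we : w · e = w by rewrite -ew -!mulA ee.
have wy : w · y = 0 by rewrite /y !mulE wx we subrr.
have y0 : y <> 0 by move/eqP; rewrite subr_eq0 => /eqP/nx.
have [z yzy] := regular y.
exists (y · z · e); split.
- by rewrite -!mulA (mulA e) ey !mulA yzy.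
- by rewrite !mulA ey -!mulA ee.
- by move=> h; apply: y0; rewrite -yzy -{2}ey mulA h mul0l.
- by move=> h; apply: w0; rewrite -we -h !mulA wy !mul0l.
Qed.

Lemma dim_corner_lt e f : e · e = e -> f · f = f -> e · f · e = f -> f <> e ->
  (\dim (corner f) < \dim (corner e))%N.
Proof.
move=> ee ff ef fe; have fE : f · e = f by rewrite -ef -!mulA ee.
have eF : e · f = f by rewrite -ef !mulA ee.
rewrite ltn_neqAle andbC dimvS /=; last first.
  apply/subvP => b /(mem_corner _ ff) hb; apply/(mem_corner _ ee).
  by rewrite -hb !mulA eF -!mulA fE.
apply: contra_notN fe => h; have /eqP sub : corner f == corner e.
  rewrite eqEdim (eqP h) leqnn andbT.
  apply/subvP => b /(mem_corner _ ff) hb; apply/(mem_corner _ ee).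
  by rewrite -hb !mulA eF -!mulA fE.
have : e \in corner f by rewrite sub; apply/(mem_corner _ ee); rewrite !ee.
by move/(mem_corner _ ff) => h'; rewrite -h' -!mulA eF ff.
Qed.

Variable tau : V -> F.
Hypothesis tauD : forall x y, tau (x + y) = tau x + tau y.
Hypothesis tauZ : forall a x, tau (a *: x) = a * tau x.

Let addr_neq0 (a b : F) : a + b != 0 -> a != 0 \/ b != 0.
Proof. by have [->|] := eqVneq a 0; [rewrite add0r; right|left]. Qed.

(** Splitting e = f + f' and c accordingly, an off-diagonal part of c is the
    difference of the idempotents f + f c f' and f. *)
Lemma corner_simple_idempotent e c : e · e = e -> e · c · e = c -> tau c != 0 ->
  exists p, [/\ p · p = p, forall b, exists a, p · b · p = a *: p,
    tau p != 0 & e · p · e = p].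
Proof.
move: {-1}(\dim _) (leqnn (\dim (corner e))) => n.
elim: n e c => [|n IHn] e c dn ee ec tc.
  move: dn; rewrite leqn0 dimv_eq0 => /eqP c0.
  have : c \in corner e by apply/(mem_corner _ ee).
  rewrite c0 memv0 => /eqP cz; case/negP: tc; rewrite cz.
  by rewrite -(scale0r c) tauZ GRing.mul0r.
have [sc|] := pselect (forall x, exists a, e · x · e = a *: e).
  exists e; split; rewrite ?ee //.
  have [a] := sc c; rewrite ec => ca; apply: contraNneq tc => te.
  by rewrite ca tauZ te mulr0.
move/existsNP => [x nx].
have [||f [ff ef f0 fe]] := @corner_idempotent e (e · x · e) ee.
- by rewrite !mulA ee -!mulA ee.
- by move=> a h; apply: nx; exists a.
have fE : f · e = f by rewrite -ef -!mulA ee.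
have eF : e · f = f by rewrite -ef !mulA ee.
have rec g d : g · g = g -> e · g · e = g -> g <> e -> g · d · g = d -> tau d != 0 ->
  exists p, [/\ p · p = p, forall b, exists a, p · b · p = a *: p,
    tau p != 0 & e · p · e = p].
  move=> gg eg ge gd td.
  have [|p [pp ps tp gp]] := IHn g d _ gg gd td.
    by rewrite -ltnS (leq_trans _ dn) // dim_corner_lt.
  by exists p; split=> //; rewrite -gp -eg !mulA ee -!mulA ee.
have offdiag g h : g · g = g -> g + h = e -> e · g · e = g -> g <> e ->
   tau (g · c · h) != 0 ->
  exists p, [/\ p · p = p, forall b, exists a, p · b · p = a *: p,
    tau p != 0 & e · p · e = p].
  move=> gg gh eg ge tgh.
  have gE : g · e = g by rewrite -eg -!mulA ee.
  have eG : e · g = g by rewrite -eg !mulA ee.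
  have hE : h = e - g by rewrite -gh addrC addKr.
  have hg : h · g = 0 by rewrite hE !mulE eG gg subrr.
  have hh : h · h = h by rewrite {2}hE !mulE hg subr0 hE !mulE ee gE.
  have he : h · e = h by rewrite hE !mulE ee gE.
  have [tg|tg] := eqVneq (tau g) 0; last by apply: (rec g g); rewrite ?gg.
  pose k := g + g · c · h.
  have kk : k · k = k.
    by rewrite /k !mulE gg -!(mulA _ h g) hg !mul0r !mul0l !addr0.
  apply: (rec k k); rewrite ?kk //.
  - by rewrite /k !mulE eG gE -!mulA he.
  - move=> ke; apply: ge; suff h0 : h = 0 by rewrite -gh h0 addr0.
    by rewrite -he -ke /k !mulE hg !mul0l addr0.
  - by rewrite /k tauD tg add0r.
have cE : c = (f · c · f + f · c · (e - f)) + ((e - f) · c · f + (e - f) · c · (e - f)).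
  by rewrite -!mulDr (addrC f) !subrK -!mulDl (addrC f) subrK ec.
have gE : (e - f) · (e - f) = e - f.
  by rewrite !mulE ee eF fE ff opprK addNr addr0.
have ge : e · (e - f) · e = e - f by rewrite !mulE !ee eF fE.
have gne : e - f <> e by move/eqP; rewrite -subr_eq0 addrAC subrr add0r oppr_eq0 => /eqP.
move: (tc); rewrite {1}cE tauD => /addr_neq0 []; rewrite tauD => /addr_neq0 [] h.
- by apply: (rec f (f · c · f)) => //; rewrite !mulA ff -!mulA ff.
- by apply: (offdiag f (e - f)) => //; rewrite addrC subrK.
- by apply: (offdiag (e - f) f) => //; rewrite subrK.
- by apply: (rec (e - f) ((e - f) · c · (e - f))) => //; rewrite !mulA gE -!mulA gE.
Qed.

(** The idempotent e = s · y satisfies e · s = s, but s need not lie in the corner of e: only s · e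
    does. The rest x = s - s · e satisfies e · x = x and x · e = 0, so e + x is a second idempotent
    in the right ideal of s. One of s · e, e and e + x has nonzero [tau]. *)
Lemma simple_idempotent s : tau s != 0 ->
  exists p z, [/\ p · p = p, forall b, exists a, p · b · p = a *: p,
    tau p != 0 & p = s · z].
Proof.
move=> ts; have [y sys] := regular s.
have fin e u c : e · e = e -> s · u = e -> e · c · e = c -> tau c != 0 ->
  exists p z, [/\ p · p = p, forall b, exists a, p · b · p = a *: p,
    tau p != 0 & p = s · z].
  move=> ee su ec tc; have [p [pp ps tp ep]] := corner_simple_idempotent ee ec tc.
  by exists p, (u · p · e); split=> //; rewrite !mulA su.
have [e [ee es se]] : exists e, [/\ e · e = e, e · s = s & s · y = e].
  by exists (s · y); rewrite !mulA sys.
have [x xE] : exists x, x = s - s · e by exists (s - s · e).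
have ex : e · x = x by rewrite xE !mulE es.
have xe : x · e = 0 by rewrite xE !mulE -(mulA s) ee subrr.
have xx : x · x = 0 by rewrite -{2}ex mulA xe mul0l.
have [tse|tse] := eqVneq (tau (s · e)) 0; last first.
  by apply: (fin e y (s · e)) => //; rewrite mulA es -mulA ee.
have [te|te] := eqVneq (tau e) 0; last by apply: (fin e y e); rewrite ?ee.
have kk : (e + x) · (e + x) = e + x.
  by rewrite mulDl !mulDr ee ex xe xx !addr0.
(* The second argument solves s · u = e + x, since s · y = e and s · y · s = s. *)
apply: (fin (e + x) (y + y · s - e) (e + x)).
- exact: kk.
- by rewrite !mulE se es xE addrA.
- by rewrite !kk.
- by rewrite xE -scaleN1r !tauD tauZ te tse mulr0 addr0 add0r.
Qed.

End RegularAlgebra.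

(** * Semisimple categories *)

Section Semisimple.
Variables (F : fieldType) (C : lincat F).
Hypothesis ss : semisimple C.
Implicit Types X Y Z : C.

Definition precomp X Y Z (f : Mor X Y) (h : Mor Y Z) : Mor X Z := h ∘ f.

Lemma precomp_linear X Y Z (f : Mor X Y) : linear (@precomp X Y Z f).
Proof. by move=> a s t; rewrite /precomp comp_linl. Qed.

HB.instance Definition _ X Y Z (f : Mor X Y) :=
  GRing.isLinear.Build F (Mor Y Z) (Mor X Z) _ (@precomp X Y Z f)
    (@precomp_linear X Y Z f).

Definition precomp_img X Y (f : Mor X Y) : {vspace Mor X X} :=
  limg (linfun (@precomp X Y X f)).

Lemma precomp_imgP X Y (f : Mor X Y) x :
  reflect (exists h, x = h ∘ f) (x \in precomp_img f).
Proof.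
apply: (iffP memv_imgP) => [[h _]|[h ->]].
  by rewrite lfunE; exists h.
by exists h; rewrite ?memvf // lfunE.
Qed.

Lemma simple_iso X Y (s : Mor X Y) : simple_ob X -> simple_ob Y -> s <> 0 ->
  exists t : Mor Y X, t ∘ s = idmor X /\ s ∘ t = idmor Y.
Proof.
move=> sX sY s0; have [[a [b [ba ab]]]|n] := pselect (iso_ob X Y); last first.
  by case: s0; apply: ss_schur n s.
have [c hc] := sX.2 (b ∘ s).
have sE : s = c *: a by rewrite -[s]comp_idl -ab -Defs.compA hc compZr comp_idr.
have c0 : c != 0 by apply/eqP => c0; apply: s0; rewrite sE c0 scale0r.
exists (c^-1 *: b); rewrite sE !(compZl, compZr) !scalerA ba ab mulVf // mulfV //.
by rewrite !scale1r.
Qed.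

Lemma factor_simple X Y (f : Mor X Y) : f <> 0 ->
  exists (T : C) (a : Mor T X) (b : Mor Y T), simple_ob T /\ b ∘ f ∘ a = idmor T.
Proof.
move=> f0; have [n [P [sP [u [v [_ _ uv]]]]]] := ss_decomp ss X.
have [n' [Q [sQ [u' [v' [_ _ uv']]]]]] := ss_decomp ss Y.
have [[i [j ij]]|h] := pselect (exists i j, v' j ∘ f ∘ u i <> 0).
  have [t [ts _]] := simple_iso (sP i) (sQ j) ij.
  by exists (P i), (u i), (t ∘ v' j); rewrite -ts !Defs.compA.
case: f0; rewrite -[f]comp_idr -[f]comp_idl -uv -uv' comp_sumr big1 // => i _.
rewrite !comp_suml big1 // => j _.
have -> : u' j ∘ v' j ∘ f ∘ (u i ∘ v i) = u' j ∘ (v' j ∘ f ∘ u i) ∘ v i.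
  by rewrite !Defs.compA.
suff -> : v' j ∘ f ∘ u i = 0 by rewrite compm0 comp0m.
by apply: contrapT => e; apply: h; exists i, j.
Qed.

Lemma split_epi_simple X Y (f : Mor X Y) : simple_ob Y -> f <> 0 ->
  exists k : Mor Y X, f ∘ k = idmor Y.
Proof.
move=> sY /factor_simple [T [a [b [sT e]]]].
have b0 : b <> 0 by move=> b0; apply: sT.1; rewrite -e b0 !comp0m.
have [b' [b'b bb']] := simple_iso sY sT b0.
exists (a ∘ b); have -> : f ∘ (a ∘ b) = b' ∘ (b ∘ f ∘ a) ∘ b.
  by rewrite !Defs.compA b'b comp_idl.
by rewrite e comp_idr.
Qed.

Lemma component_neq0 X Y (f : Mor X Y) : f <> 0 ->
  exists (T : C) (b : Mor Y T), simple_ob T /\ b ∘ f <> 0.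
Proof.
move=> /factor_simple [T [a [b [sT e]]]]; exists T, b; split=> // h.
by apply: sT.1; rewrite -e h comp0m.
Qed.

(** Splitting off a simple summand on which f is nonzero makes the left ideal
    of the morphisms [h ∘ f] smaller. *)
Lemma regular_mor X Y (f : Mor X Y) : exists h : Mor Y X, f ∘ h ∘ f = f.
Proof.
have [n] := ubnP (\dim (precomp_img f)).
elim: n f => // n IHn f.
have [->|/eqP f0] := eqVneq f 0; first by exists 0; rewrite !compm0.
have [T [a [b [sT e]]]] := factor_simple f0; rewrite ltnS => dn.
have [g [gE gE' gf]] : exists g, [/\ g = (idmor Y - f ∘ a ∘ b) ∘ f,
  g = f ∘ (idmor X - a ∘ b ∘ f) & g + f ∘ a ∘ b ∘ f = f].
  exists (f - f ∘ a ∘ b ∘ f); split; last by rewrite subrK.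
    by rewrite compBl comp_idl.
  by rewrite compBr comp_idr !Defs.compA.
have ga : g ∘ a = 0.
  rewrite gE compBl comp_idl compBl -!Defs.compA (Defs.compA b) e.
  by rewrite comp_idr subrr.
have sub : (precomp_img g <= precomp_img f)%VS.
  apply/subvP => _ /precomp_imgP [x ->]; rewrite gE Defs.compA.
  by apply/precomp_imgP; exists (x ∘ (idmor Y - f ∘ a ∘ b)).
have [h hh] : exists h, g ∘ h ∘ g = g.
  (* If both left ideals were equal, a ∘ b ∘ f would be a multiple x ∘ g, and g ∘ a = 0 would make
     the identity of T vanish. *)
  apply: IHn; apply: leq_trans dn; rewrite ltn_neqAle dimvS // andbT.
  apply/negP => de; have /eqP sub' : precomp_img g == precomp_img f.
    by rewrite eqEdim sub (eqP de) leqnn.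
  have /precomp_imgP [x ex] : a ∘ b ∘ f \in precomp_img g.
    by rewrite sub'; apply/precomp_imgP; exists (a ∘ b).
  apply: sT.1; rewrite -e -[b ∘ f ∘ a]comp_idl -e.
  have -> : b ∘ f ∘ a ∘ (b ∘ f ∘ a) = b ∘ f ∘ (a ∘ b ∘ f) ∘ a.
    by rewrite !Defs.compA.
  by rewrite ex -!Defs.compA ga !compm0.
(* Between two copies of f, the first summand gives g ∘ h ∘ g = g and the second the part f ∘ a ∘ b
   ∘ f split off. *)
exists ((idmor X - a ∘ b ∘ f) ∘ h ∘ (idmor Y - f ∘ a ∘ b) + a ∘ b).
rewrite compDr compDl !Defs.compA -gE' -[_ ∘ _ ∘ f]Defs.compA -gE hh.
exact: gf.
Qed.

End Semisimple.

(** * Nonvanishing of the dimension of simple objects *)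

Section QuantumDimension.
Variables (F : fieldType) (C : BTC F).

(** Regularity of [coev X] gives h with h ∘ coev nonzero. By duality the morphisms from X ⊗ [dual X]
    to 1 correspond to End X = F, so h is a multiple of ev ∘ br, and this differs from [evbar X] by
    the twist, a nonzero scalar. *)
Lemma qdim_neq0 (X : C) : simple_ob X -> evbar X ∘ coev X <> 0.
Proof.
move=> sX; have ss := btc_semisimple C.
have zz : (X ◁ ⟨ev X⟩) • (⟨coev X⟩ ▷ X) = ⟨idmor X⟩.
  by rewrite -(zigzag X) acomp_eqmr acompE acomp_eqmr acomp_eqml.
have zzd : (⟨ev X⟩ ▷ dual X) • (dual X ◁ ⟨coev X⟩) = ⟨idmor (dual X)⟩.
  by rewrite -(zigzag_dual X) acomp_eqmr acompE acomp_eqmr acomp_eqml.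
have c0 : coev X <> 0.
  move=> h; apply: sX.1; apply: Arrow_inj.
  rewrite -zz h rwh0 acomp0r /=; apply: Arrow0; by rewrite ?tens1x ?tensx1.
have [h hc] := regular_mor ss (coev X).
have hc0 : h ∘ coev X <> 0 by move=> e; apply: c0; rewrite -hc -Defs.compA e compm0.
pose r := h ∘ bri X (dual X).
(* The transpose of r under duality; as X is simple it is a scalar, which makes r a multiple of
   [ev X]. *)
pose y := eqm (tensx1 X) ∘ (idmor X ⊠ r) ∘ asci X (dual X) X
      ∘ (coev X ⊠ idmor X) ∘ eqm (esym (tens1x X)).
have yE : ⟨y⟩ = (X ◁ ⟨r⟩) • (⟨coev X⟩ ▷ X).
  by rewrite /y acomp_eqmr acompE acomp_eqmr acomp_eqml.
have rE : ⟨r⟩ = ⟨ev X ∘ (idmor (dual X) ⊠ y)⟩.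
  rewrite acompE lwhE yE; layers.
  crw - (wh_exch (ev X) r); crwr X zzd.
  by rewrite rwh_id acomp_idr.
have [a ya] := sX.2 y; have [mu tmu] := sX.2 (twist X).
have hE : h = a *: (ev X ∘ br X (dual X)).
  rewrite -[h]comp_idr -brK Defs.compA -/r (Arrow_inj rE) ya tensmZr tensm_id.
  by rewrite compZr comp_idr compZl.
have mu0 : mu != 0.
  apply/eqP => mu0; have [t [tt _]] := twist_inv X.
  by apply: sX.1; rewrite -tt tmu mu0 scale0r compm0.
move=> e; apply: hc0; rewrite hE compZl.
move: e; rewrite /evbar tmu tensmZl tensm_id compZr comp_idr compZl => /eqP.
by rewrite scaler_eq0 (negPf mu0) => /eqP ->; rewrite scaler0.
Qed.

End QuantumDimension.

(** * The regular algebra of Rep G *)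

Lemma lfun_basis_ext (F : fieldType) (U W : vectType F) (X : seq U) (f g : 'Hom(U, W)) :
  basis_of fullv X -> (forall x, x \in X -> f x = g x) -> f = g.
Proof.
move=> /span_basis bX fg; apply/lfunP => v.
have : v \in <<X>>%VS by rewrite bX memvf.
move/(@coord_span _ _ _ (in_tuple X)) => ->; rewrite !linear_sum; apply: eq_bigr => i _.
by rewrite !linearZ /= fg // mem_nth.
Qed.

Section RegularRep.
Variables (F : fieldType) (gT : finGroupType).

(** Right translations commute with the left regular action, hence come from endomorphisms of Γ. *)
Definition rtrans (g : gT) (f : {ffun gT -> F^o}) : {ffun gT -> F^o} :=
  [ffun h => f (h * g)%g].

Lemma rtrans_linear g : linear (rtrans g).
Proof. by move=> a f f'; apply/ffunP => h; rewrite !ffunE. Qed.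

HB.instance Definition _ g :=
  GRing.isLinear.Build F {ffun gT -> F^o} {ffun gT -> F^o} _ (rtrans g)
    (rtrans_linear g).

Lemma regrep_delta (f : regrep F gT) : f = \sum_a (f a : F) *: deltaG F a.
Proof.
apply/ffunP => h; rewrite sum_ffunE (bigD1 h) //= big1 => [|a ah].
  by rewrite !ffunE eqxx addr0 /= [RHS]mulr1.
by rewrite !ffunE eq_sym (negPf ah) scaler0.
Qed.

Lemma ltrans_delta g a : Defs.ract (regrep F gT) g (deltaG F a) = deltaG F (g * a)%g.
Proof.
rewrite /= lfunE /=; apply/ffunP => h; rewrite !ffunE.
by rewrite (canF_eq (mulKVg g)).
Qed.

Lemma rtrans_delta g a : rtrans g (deltaG F a) = deltaG F (a * g^-1)%g.
Proof.
apply/ffunP => h; rewrite !ffunE.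
by rewrite (canF_eq (mulgK g)).
Qed.

End RegularRep.

(** What is used of the algebra of functions on G; [rho k] is translation by k. *)
Record regular_algebra (F : fieldType) (C : BTC F) (S : set C) (gT : finGroupType)
    (A : frob_data C) (rho : gT -> Mor (Gam A) (Gam A)) : Prop := {
  ra_in : S (Gam A);
  ra_coassoc : (⟨acomul A⟩ ▷ Gam A) • ⟨acomul A⟩ = (Gam A ◁ ⟨acomul A⟩) • ⟨acomul A⟩;
  ra_counitl : (⟨acnt A⟩ ▷ Gam A) • ⟨acomul A⟩ = ⟨idmor (Gam A)⟩;
  ra_counitr : (Gam A ◁ ⟨acnt A⟩) • ⟨acomul A⟩ = ⟨idmor (Gam A)⟩;
  ra_cocomm : ⟨br (Gam A) (Gam A)⟩ • ⟨acomul A⟩ = ⟨acomul A⟩;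
  ra_unitl : ⟨amul A⟩ • (⟨aunt A⟩ ▷ Gam A) = ⟨idmor (Gam A)⟩;
  ra_frob_r : ((⟨acnt A⟩ • ⟨amul A⟩) ▷ Gam A) • (Gam A ◁ ⟨acomul A⟩) = ⟨amul A⟩;
  ra_frob_l : (Gam A ◁ (⟨acnt A⟩ • ⟨amul A⟩)) • (⟨acomul A⟩ ▷ Gam A) = ⟨amul A⟩;
  ra_special : amul A ∘ acomul A = #|gT|%:R *: idmor (Gam A);
  ra_counit_unit : acnt A ∘ aunt A = idmor tunit;
  ra_counit_simple : forall s : Mor (Gam A) tunit, exists a, s = a *: acnt A;
  ra_unit_simple : forall s : Mor tunit (Gam A), exists a, s = a *: aunt A;
  ra_rhoM : forall k l, rho k ∘ rho l = rho (k * l)%g;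
  ra_rho_twist : forall k,
    ⟨rho k⟩ • ((⟨acnt A⟩ • ⟨amul A⟩ • (⟨rho k⟩ ▷ Gam A)) ▷ Gam A)
      • (Gam A ◁ ⟨br (Gam A) (Gam A)⟩) • (⟨acomul A⟩ ▷ Gam A)
    = ⟨amul A⟩ • (⟨rho k⟩ ▷ Gam A);
  ra_sum_rho : \sum_k rho k = #|gT|%:R *: (aunt A ∘ acnt A);
  ra_rho_sum_inj : forall P Q : pred gT,
    \sum_(k | P k) rho k = \sum_(k | Q k) rho k -> P =1 Q;
  ra_rho_aut : forall k, AutAlg A (rho k);
  ra_aut_rho : forall g, AutAlg A g -> exists k, g = rho k;
  ra_simple : forall X, S X -> idmor X <> 0 -> exists s : Mor X (Gam A), s <> 0 }.

(** * Calculation with elements of the representation spaces *)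

Section Fiber.
Variables (F : fieldType) (C : BTC F) (S : set C).
Hypothesis hS : tensor_subcat S.
Variables (gT : finGroupType) (E : rep_functor C gT).
Hypothesis hE : sym_tensor_equiv S E.
Implicit Types X Y Z : C.

Let S1 : S tunit := sub_one hS.
Let ST X Y : S X -> S Y -> S (X ⊗ Y) := @sub_tens _ _ _ hS X Y.

Lemma fmor_comp X Y Z (t : Mor Y Z) (s : Mor X Y) x : S X -> S Y -> S Z ->
  fmor E (t ∘ s) x = fmor E t (fmor E s x).
Proof. by move=> *; rewrite (Defs.eq_comp hE) // comp_lfunE. Qed.

Lemma fmor_id X x : S X -> fmor E (idmor X) x = x.
Proof. by move=> *; rewrite (eq_id hE) // id_lfunE. Qed.

Lemma fmor0 X Y : S X -> S Y -> fmor E (0 : Mor X Y) = 0.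
Proof.
move=> sX sY; have := eq_lin hE 1 (0 : Mor X Y) 0 sX sY; rewrite !scale1r addr0.
by move/esym/(canRL (addrK _)); rewrite subrr.
Qed.

Lemma fmorD X Y (s t : Mor X Y) : S X -> S Y -> fmor E (s + t) = fmor E s + fmor E t.
Proof. by move=> *; rewrite -{1}[s]scale1r (eq_lin hE) // scale1r. Qed.

Lemma fmorZ X Y a (s : Mor X Y) : S X -> S Y -> fmor E (a *: s) = a *: fmor E s.
Proof. by move=> *; rewrite -[a *: s]addr0 (eq_lin hE) // fmor0 // addr0. Qed.

Lemma fmor_sum X Y (I : finType) (P : pred I) (s : I -> Mor X Y) : S X -> S Y ->
  fmor E (\sum_(i | P i) s i) = \sum_(i | P i) fmor E (s i).
Proof.
move=> sX sY; apply: (big_morph (fmor E)); last exact: fmor0.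
by move=> *; apply: fmorD.
Qed.

Lemma fmor_tens X X' Y Y' (s : Mor X X') (t : Mor Y Y') (x : E X) (y : E Y) :
    S X -> S X' -> S Y -> S Y' ->
  fmor E (s ⊠ t) (ften E x y) = ften E (fmor E s x) (fmor E t y).
Proof. exact: eq_ten_nat. Qed.

Lemma fmor_asci X Y Z (x : E X) (y : E Y) (z : E Z) : S X -> S Y -> S Z ->
  fmor E (asci X Y Z) (ften E (ften E x y) z) = ften E x (ften E y z).
Proof.
move=> sX sY sZ; rewrite -(eq_tenA hE) // -fmor_comp; try by do !apply: ST.
have -> : asci X Y Z ∘ asc X Y Z = idmor _.
  by apply: Arrow_inj; rewrite acomp_eqml Arrow_eqm.
by rewrite fmor_id //; do !apply: ST.
Qed.

Lemma fmor_eqm1x X (x : E X) : S X ->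
  fmor E (eqm (esym (tens1x X))) x = ften E (fone E) x.
Proof.
move=> sX; rewrite -{1}(eq_ten1x hE x) // -fmor_comp; try by do ?apply: ST.
have -> : eqm (esym (tens1x X)) ∘ eqm (tens1x X) = idmor _.
  by apply: Arrow_inj; rewrite acomp_eqml Arrow_eqm.
by rewrite fmor_id //; apply: ST.
Qed.

Lemma ften0l X Y (y : E Y) : S X -> S Y -> ften E (0 : E X) y = 0.
Proof.
move=> sX sY; have := eq_tenl hE 1 (0 : E X) 0 y sX sY; rewrite !scale1r addr0.
by move/esym/(canRL (addrK _)); rewrite subrr.
Qed.

Lemma ften0r X Y (x : E X) : S X -> S Y -> ften E x (0 : E Y) = 0.
Proof.
move=> sX sY; have := eq_tenr hE 1 x (0 : E Y) 0 sX sY; rewrite !scale1r addr0.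
by move/esym/(canRL (addrK _)); rewrite subrr.
Qed.

Lemma ftenZl X Y a (x : E X) (y : E Y) : S X -> S Y ->
  ften E (a *: x) y = a *: ften E x y.
Proof. by move=> *; rewrite -[a *: x]addr0 (eq_tenl hE) // ften0l // addr0. Qed.

Lemma ftenZr X Y a (x : E X) (y : E Y) : S X -> S Y ->
  ften E x (a *: y) = a *: ften E x y.
Proof. by move=> *; rewrite -[a *: y]addr0 (eq_tenr hE) // ften0r // addr0. Qed.

Lemma ften_suml X Y (I : finType) (x : I -> E X) (y : E Y) : S X -> S Y ->
  ften E (\sum_i x i) y = \sum_i ften E (x i) y.
Proof.
move=> sX sY; apply: (big_morph (fun x => ften E x y)); last exact: ften0l.
by move=> x1 x2; rewrite -{1}[x1]scale1r (eq_tenl hE) // scale1r.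
Qed.

Lemma ften_sumr X Y (I : finType) (x : E X) (y : I -> E Y) : S X -> S Y ->
  ften E x (\sum_i y i) = \sum_i ften E x (y i).
Proof.
move=> sX sY; apply: (big_morph (ften E x)); last exact: ften0r.
by move=> x1 x2; rewrite -{1}[x1]scale1r (eq_tenr hE) // scale1r.
Qed.

Lemma fmor_scale X Y (s : Mor X Y) a x : fmor E s (a *: x) = a *: fmor E s x.
Proof. exact: linearZ. Qed.

Lemma fmor_ext X Y (s t : Mor X Y) : S X -> S Y ->
  (forall x, fmor E s x = fmor E t x) -> s = t.
Proof. by move=> sX sY st; apply: (eq_faithful hE) => //; apply/lfunP. Qed.

Lemma fmor_tens_ext X Y Z (s t : Mor (X ⊗ Y) Z) : S X -> S Y -> S Z ->
  (forall x y, fmor E s (ften E x y) = fmor E t (ften E x y)) -> s = t.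
Proof.
move=> sX sY sZ st; apply: (eq_faithful hE) => //; first exact: ST.
apply: (lfun_basis_ext (eq_tenb hE sX sY)) => _ /allpairsP [[x y] [_ _ ->]].
exact: st.
Qed.

Lemma fiber_unit (x : E tunit) : exists c, x = c *: fone E.
Proof.
have := coord_basis (eq_oneb hE) (memvf x).
by rewrite big_ord1 => ->; eexists.
Qed.

(** * The algebra of functions on G, checked on delta functions *)

Section Frobenius.
Variable A : frob_data C.
Local Notation G := (Gam A).
Local Notation D := (acomul A).
Local Notation m := (amul A).
Local Notation ep := (acnt A).
Local Notation et := (aunt A).
Hypothesis sG : S G.
Variable u : 'Hom(regrep F gT, E G).
Hypotheses (u_eq : equivariant u) (u_bij : bijective u).
Hypothesis mE : forall f f' : regrep F gT,
  fmor E m (ften E (u f) (u f')) = u [ffun h => f h * f' h].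
Hypothesis etE : fmor E et (fone E) = u [ffun=> 1].
Hypothesis DE : forall g, fmor E D (u (deltaG F g)) =
  #|gT|%:R *: ften E (u (deltaG F g)) (u (deltaG F g)).
Hypothesis epE : forall g, fmor E ep (u (deltaG F g)) = #|gT|%:R^-1 *: fone E.
Hypothesis cardG : #|gT|%:R != 0 :> F.

Local Notation d a := (u (deltaG F a)).

Lemma fiber_delta (x : E G) : exists c : gT -> F, x = \sum_a c a *: d a.
Proof.
have [v _ uv] := u_bij; exists (v x); rewrite -[LHS]uv {1}(regrep_delta (v x)).
by rewrite linear_sum; apply: eq_bigr => a _; rewrite linearZ.
Qed.

Lemma delta_inj (c c' : gT -> F) :
  \sum_a c a *: d a = \sum_a c' a *: d a -> c =1 c'.
Proof.
have uE (b : gT -> F) : \sum_a b a *: d a = u [ffun a => b a].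
  rewrite [in RHS](regrep_delta [ffun a => b a]) linear_sum; apply: eq_bigr => a _.
  by rewrite linearZ /= ffunE.
by rewrite !uE => /(bij_inj u_bij)/ffunP e a; have := e a; rewrite !ffunE.
Qed.

Lemma gam_ext Y (s t : Mor G Y) : S Y ->
  (forall a, fmor E s (d a) = fmor E t (d a)) -> s = t.
Proof.
move=> sY st; apply: fmor_ext => // x; have [c ->] := fiber_delta x.
by rewrite !linear_sum; apply: eq_bigr => a _; rewrite !linearZ /= st.
Qed.

Lemma gam2_ext Y (s t : Mor (G ⊗ G) Y) : S Y ->
  (forall a b, fmor E s (ften E (d a) (d b)) = fmor E t (ften E (d a) (d b))) -> s = t.
Proof.
move=> sY st; apply: fmor_tens_ext => // x y.
have [c ->] := fiber_delta x; have [c' ->] := fiber_delta y.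
rewrite ften_suml // !linear_sum; apply: eq_bigr => a _.
rewrite ftenZl // ften_sumr // !linearZ !linear_sum /=; congr (_ *: _).
by apply: eq_bigr => b _; rewrite ftenZr // !linearZ /= st.
Qed.

Lemma mulE a b : fmor E m (ften E (d a) (d b)) = (a == b)%:R *: d a.
Proof.
rewrite mE; have -> : [ffun h => deltaG F a h * deltaG F b h] = (a == b)%:R *: deltaG F a.
  apply/ffunP => h; rewrite !ffunE /=.
  have [->|] := eqVneq h a; last by rewrite mul0r scaler0.
  by rewrite mul1r [RHS]mulr1.
by rewrite linearZ.
Qed.

Lemma untE : fmor E et (fone E) = \sum_a d a.
Proof.
rewrite etE (regrep_delta [ffun=> 1]) linear_sum; apply: eq_bigr => a _.
by rewrite ffunE scale1r.
Qed.

Ltac S_auto := do ?[exact: S1 | exact: sG | assumption | apply: ST].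

Lemma rho_exists : exists rho : gT -> Mor G G,
  forall k a, fmor E (rho k) (d a) = d (a * k^-1)%g.
Proof.
suff /choice [rho rhoE] : forall k, exists s : Mor G G, forall a,
    fmor E s (d a) = d (a * k^-1)%g by exists rho.
move=> k; have uK : lker u == 0%VS by apply/lker0P; apply: bij_inj.
have /(eq_full hE sG sG) [s sE] :
    equivariant (u \o (linfun (@rtrans F gT k) \o u^-1))%VF.
  move=> g x; have [c ->] := fiber_delta x.
  rewrite !linear_sum /=; apply: eq_bigr => a _; rewrite !linearZ /=; congr (_ *: _).
  rewrite -u_eq ltrans_delta !comp_lfunE !lker0_lfunK // !lfunE /= !rtrans_delta.
  by rewrite -u_eq ltrans_delta mulgA.
exists s => a; rewrite sE !comp_lfunE lker0_lfunK // lfunE /=.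
by rewrite rtrans_delta.
Qed.

Ltac ev_with L := rewrite L; [|solve [S_auto] ..].
Ltac ev := repeat first
  [ ev_with fmor_comp | ev_with fmor_tens | ev_with (eq_tenA hE) | ev_with fmor_asci
  | ev_with (eq_ten1x hE) | ev_with (eq_tenx1 hE) | ev_with fmor_eqm1x
  | ev_with (eq_br hE) | ev_with fmor_id
  | rewrite DE | rewrite epE | rewrite mulE | rewrite fmor_scale
  | ev_with ftenZl | ev_with ftenZr ].

Lemma gam_coassoc : (⟨D⟩ ▷ G) • ⟨D⟩ = (G ◁ ⟨D⟩) • ⟨D⟩.
Proof.
rewrite -rwhE -acompE; transitivity ⟨asc G G G ∘ (idmor G ⊠ D) ∘ D⟩; last first.
  by rewrite acompE acomp_eqml.
by congr Arrow; apply: gam_ext => [|a]; [S_auto|ev].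
Qed.

Lemma gam_counitl : (⟨ep⟩ ▷ G) • ⟨D⟩ = ⟨idmor G⟩.
Proof.
rewrite -rwhE -(acomp_eqml (tens1x G) (ep ⊠ idmor G)) -acompE.
congr Arrow; apply: gam_ext => [|a]; [S_auto|ev].
by rewrite scalerA mulfV // scale1r.
Qed.

Lemma gam_counitr : (G ◁ ⟨ep⟩) • ⟨D⟩ = ⟨idmor G⟩.
Proof.
rewrite -lwhE -(acomp_eqml (tensx1 G) (idmor G ⊠ ep)) -acompE.
congr Arrow; apply: gam_ext => [|a]; [S_auto|ev].
by rewrite scalerA mulfV // scale1r.
Qed.

Lemma gam_cocomm : ⟨br G G⟩ • ⟨D⟩ = ⟨D⟩.
Proof. by rewrite -acompE; congr Arrow; apply: gam_ext => [|a]; [S_auto|ev]. Qed.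

Lemma gam_unitl : ⟨m⟩ • (⟨et⟩ ▷ G) = ⟨idmor G⟩.
Proof.
rewrite -rwhE -acompE -(acomp_eqmr (esym (tens1x G))).
congr Arrow; apply: gam_ext => [|a]; [S_auto|ev].
rewrite untE ften_suml // linear_sum (bigD1 a) //= big1 => [|b ba]; ev.
  by rewrite eqxx scale1r addr0.
by rewrite (negPf ba) scale0r.
Qed.

Lemma gam_frob_r : ((⟨ep⟩ • ⟨m⟩) ▷ G) • (G ◁ ⟨D⟩) = ⟨m⟩.
Proof.
rewrite -acompE -rwhE -lwhE -(acomp_eqml (tens1x G) ((ep ∘ m) ⊠ _)).
rewrite -(acomp_eqmr (tensA G G G)) -acompE.
congr Arrow; apply: gam2_ext => [|a b]; [S_auto|ev].
have [->|ab] := eqVneq a b; last by rewrite !scale0r scaler0.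
by rewrite !scale1r scalerA mulfV // scale1r.
Qed.

Lemma gam_frob_l : (G ◁ (⟨ep⟩ • ⟨m⟩)) • (⟨D⟩ ▷ G) = ⟨m⟩.
Proof.
rewrite -acompE -rwhE -lwhE -(acomp_eqml (tensx1 G) (_ ⊠ (ep ∘ m))).
rewrite -(acomp_eqmr (esym (tensA G G G))) -acompE.
congr Arrow; apply: gam2_ext => [|a b]; [S_auto|ev].
have [->|ab] := eqVneq a b; last by rewrite !scale0r scaler0.
by rewrite !scale1r scalerA mulfV // scale1r.
Qed.

Lemma gam_special : m ∘ D = #|gT|%:R *: idmor G.
Proof.
apply: gam_ext => [|a]; [S_auto|ev].
by rewrite fmorZ // scale_lfunE fmor_id // eqxx scale1r.
Qed.

Lemma gam_counit_unit : ep ∘ et = idmor tunit.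
Proof.
apply: fmor_ext; [S_auto|S_auto|move=> x].
have [c ->] := fiber_unit x.
ev; rewrite untE linear_sum; congr (_ *: _).
under eq_bigr do rewrite /= epE.
by rewrite sumr_const -scaler_nat scalerA mulfV // scale1r.
Qed.

(** The delta functions form one orbit of G, so an invariant form is determined by its value at
    $\delta_1$; the factor $|G|$ undoes $\varepsilon(\delta_1)=|G|^{-1}$. *)
Lemma gam_counit_simple (s : Mor G tunit) : exists a, s = a *: ep.
Proof.
have [c cE] := fiber_unit (fmor E s (d 1%g)).
exists (#|gT|%:R * c); apply: gam_ext => [|a]; [S_auto|].
rewrite fmorZ //; try S_auto.
rewrite scale_lfunE epE scalerA mulrAC mulfV // mul1r -cE.
rewrite -{1}[a]mulg1 -ltrans_delta u_eq (eq_equiv hE) //; try S_auto.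
by rewrite cE linearZ /= (eq_oneG hE).
Qed.

Lemma gam_unit_simple (s : Mor tunit G) : exists a, s = a *: et.
Proof.
have [c cE] := fiber_delta (fmor E s (fone E)).
exists (c 1%g); apply: fmor_ext => // x.
have [b ->] := fiber_unit x.
rewrite !linearZ /= fmorZ // scale_lfunE; congr (_ *: _); rewrite untE cE.
have inv g : \sum_a c a *: d (g * a)%g = \sum_a c a *: d a.
  rewrite -cE -[X in fmor E s X](eq_oneG hE g) (eq_equiv hE) // cE linear_sum.
  by apply: eq_bigr => a _; rewrite linearZ /= -u_eq ltrans_delta.
rewrite scaler_sumr; apply: eq_bigr => g _; congr (_ *: _).
have := inv g; rewrite (reindex_inj (mulgI g^-1)%g) /=.
under eq_bigr do rewrite mulKVg.
by move/delta_inj/(_ g) <-; rewrite mulVg.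
Qed.

Variable rho : gT -> Mor G G.
Hypothesis rhoE : forall k a, fmor E (rho k) (d a) = d (a * k^-1)%g.

Lemma rhoM k l : rho k ∘ rho l = rho (k * l)%g.
Proof. by apply: gam_ext => // a; ev; rewrite !rhoE invMg mulgA. Qed.

(** At $\delta_a\otimes\delta_b$ both sides are $\delta_b$ if $b=ak^{-1}$ and 0 otherwise. *)
Lemma rho_twist k :
  ⟨rho k⟩ • ((⟨ep⟩ • ⟨m⟩ • (⟨rho k⟩ ▷ G)) ▷ G) • (G ◁ ⟨br G G⟩) • (⟨D⟩ ▷ G)
    = ⟨m⟩ • (⟨rho k⟩ ▷ G).
Proof.
transitivity ⟨rho k ∘ eqm (tens1x G) ∘ ((ep ∘ m ∘ (rho k ⊠ idmor G)) ⊠ idmor G)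
    ∘ asc G G G ∘ (idmor G ⊠ br G G) ∘ asci G G G ∘ (D ⊠ idmor G)⟩.
  rewrite acompE acomp_eqmr acompE acomp_eqmr acompE acomp_eqmr -!acompA.
  by rewrite lwhE !rwhE !acompE rwhE -!acompA.
rewrite -rwhE -acompE; congr Arrow; apply: gam2_ext => // a b.
ev; rewrite !rhoE; ev; rewrite !rhoE.
by rewrite !scalerA mulrAC mulfV // mul1r.
Qed.

Lemma sum_rho : \sum_k rho k = #|gT|%:R *: (et ∘ ep).
Proof.
apply: gam_ext => // a; rewrite fmor_sum // sum_lfunE.
rewrite fmorZ // scale_lfunE; ev; rewrite scalerA mulfV // scale1r untE.
rewrite (reindex_inj (h := fun k => k^-1 * a)%g) /=; last first.
  by move=> x y /mulIg /invg_inj.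
by apply: eq_bigr => k _; rewrite rhoE invMg invgK mulKVg.
Qed.

Lemma rho_sum_inj (P Q : pred gT) :
  \sum_(k | P k) rho k = \sum_(k | Q k) rho k -> P =1 Q.
Proof.
move=> e k; have := congr1 (fun s => fmor E s (d 1%g)) e; rewrite !fmor_sum // !sum_lfunE.
have h (R : pred gT) : \sum_(k | R k) fmor E (rho k) (d 1%g)
    = \sum_k (R k^-1)%g%:R *: d k.
  rewrite (reindex_inj invg_inj) big_mkcond; apply: eq_bigr => g _ /=.
  by rewrite rhoE mul1g invgK; case: (R _); rewrite ?scale1r ?scale0r.
rewrite !h => /delta_inj /(_ k^-1)%g; rewrite invgK.
by case: (P k) (Q k) => [] [] // /eqP; rewrite ?(oner_eq0, eq_sym 0).
Qed.

Lemma rho_aut k : AutAlg A (rho k).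
Proof.
split.
  apply: gam2_ext => // a b; ev; rewrite !rhoE mulE.
  by rewrite (inj_eq (mulIg _)).
apply: fmor_ext => // x.
have [c ->] := fiber_unit x.
rewrite fmor_comp // !fmor_scale untE; congr (_ *: _); rewrite linear_sum /=.
under eq_bigr do rewrite rhoE.
by rewrite [RHS](reindex_inj (mulIg k^-1)%g).
Qed.

(** As g commutes with left translations, it is determined by the coefficients w of $g(\delta_1)$.
    Multiplicativity makes the values of w orthogonal idempotents of F and the unit makes their sum
    1, so w is 1 at one point c and 0 elsewhere. *)
Lemma aut_rho (g : Mor G G) : AutAlg A g -> exists k, g = rho k.
Proof.
move=> [gm gu].
have [w wE] := fiber_delta (fmor E g (d 1%g)).
have gE a : fmor E g (d a) = \sum_h w (a^-1 * h)%g *: d h.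
  rewrite -{1}[a]mulg1 -ltrans_delta u_eq (eq_equiv hE) // wE linear_sum.
  rewrite (reindex_inj (mulgI a^-1)%g) /=; apply: eq_bigr => h _.
  by rewrite linearZ /= -u_eq ltrans_delta mulKVg.
have mulw (c c' : gT -> F) :
    fmor E m (ften E (\sum_a c a *: d a) (\sum_a c' a *: d a))
    = \sum_a (c a * c' a) *: d a.
  rewrite ften_suml // linear_sum; apply: eq_bigr => a _.
  rewrite ften_sumr // linear_sum (bigD1 a) //= big1 => [|b ba]; ev.
    by rewrite eqxx scale1r addr0 scalerA mulrC.
  by rewrite eq_sym (negPf ba) scale0r !scaler0.
have orth a b h : (a == b)%:R * w (a^-1 * h)%g = w (a^-1 * h)%g * w (b^-1 * h)%g.
  have := congr1 (fun s => fmor E s (ften E (d a) (d b))) gm.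
  rewrite /= !fmor_comp //; try S_auto.
  rewrite fmor_tens // mulE fmor_scale !gE mulw scaler_sumr.
  under eq_bigr do rewrite scalerA.
  by move/delta_inj/(_ h).
have sum1 : \sum_a w a = 1.
  have := congr1 (fun s => fmor E s (fone E)) gu; rewrite /= fmor_comp // untE.
  rewrite linear_sum /=; under eq_bigr do rewrite gE.
  rewrite exchange_big /=; under eq_bigr do rewrite -scaler_suml.
  under [RHS]eq_bigr do rewrite -[u _]scale1r.
  move/delta_inj/(_ 1%g); rewrite (reindex_inj invg_inj) /=.
  by under eq_bigr do rewrite mulg1 invgK.
have [c wc] : exists c, w c != 0.
  apply: contrapT => h; move: sum1 (oner_neq0 F); rewrite big1 => [<-|a _].
    by rewrite eqxx.
  by apply/eqP; apply: contrapT => wa; apply: h; exists a; apply/negP.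
have w1 : w c = 1.
  have := orth 1%g 1%g c; rewrite eqxx mul1r invg1 !mul1g => e.
  by apply: (mulfI wc); rewrite -e mulr1.
have w0 b : b != c -> w b = 0.
  move=> bc; have := orth c^-1%g b^-1%g 1%g.
  rewrite !mulg1 !invgK w1 mul1r mulr1 => <-.
  by rewrite (inj_eq invg_inj) eq_sym (negPf bc).
exists c^-1%g; apply: gam_ext => // a; rewrite gE rhoE invgK.
rewrite (bigD1 (a * c)%g) //= mulKg w1 scale1r big1 ?addr0 // => h hac.
rewrite w0 ?scale0r //; apply: contraNneq hac => <-.
by rewrite mulKVg.
Qed.

(** Matrix coefficients: a linear form λ gives the equivariant map
    $x\mapsto(h\mapsto\lambda(h^{-1}x))$, nonzero at $h=1$ if $\lambda(x)\neq0$. Here λ is a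
    coordinate. *)
Lemma simple_gam X : S X -> idmor X <> 0 -> exists s : Mor X G, s <> 0.
Proof.
move=> sX X0.
have [v v0] : exists v : E X, v <> 0.
  apply: contrapT => h; apply: X0; apply: fmor_ext => // x.
  have -> : x = 0 by apply: contrapT => x0; apply: h; exists x.
  by rewrite !linear0.
have [i vi] : exists i, coord (vbasis {: E X}) i v != 0.
  apply: contrapT => h; apply: v0; rewrite (coord_vbasis (memvf v)) big1 // => i _.
  have -> : coord (vbasis {: E X}) i v = 0; last by rewrite scale0r.
  by apply/eqP; apply: contrapT => wa; apply: h; exists i; apply/negP.
pose f x : {ffun gT -> F^o} :=
  [ffun h : gT => coord (vbasis {: E X}) i (Defs.ract (E X) h^-1%g x) : F^o].
have fl : linear f.
  by move=> a x y; apply/ffunP => h; rewrite !ffunE !linearP.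
pose fL : {linear E X -> {ffun gT -> F^o}} :=
  HB.pack f (GRing.isLinear.Build F (E X) {ffun gT -> F^o} _ f fl).
have /(eq_full hE sX sG) [s sE] : equivariant (u \o linfun fL)%VF.
  move=> g x; rewrite !comp_lfunE -u_eq !lfunE /=; congr (u _).
  apply/ffunP => h; rewrite !ffunE invMg invgK.
  by rewrite (ractM (E X)) comp_lfunE.
exists s => s0; case/eqP: vi.
have : fmor E s v = 0 by rewrite s0 fmor0 // lfunE.
rewrite sE comp_lfunE lfunE /= -(linear0 u) => /(bij_inj u_bij) /ffunP /(_ 1%g).
by rewrite !ffunE invg1 (ract1 (E X)) id_lfunE.
Qed.

End Frobenius.

Lemma regular_frobenius_algebra (A : frob_data C) : regular_frobenius S E A ->
  #|gT|%:R != 0 :> F -> exists rho, @regular_algebra F C S gT A rho.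
Proof.
move=> [sG [u [[u_eq u_bij] mE etE DE epE]]] cardG.
have [rho rhoE] := rho_exists sG u_eq u_bij.
exists rho; split => //.
- exact: gam_coassoc DE.
- exact: gam_counitl DE epE cardG.
- exact: gam_counitr DE epE cardG.
- exact: gam_cocomm DE.
- exact: gam_unitl mE etE.
- exact: gam_frob_r mE DE epE cardG.
- exact: gam_frob_l mE DE epE cardG.
- exact: gam_special mE DE.
- exact: gam_counit_unit etE epE cardG.
- exact: gam_counit_simple epE cardG.
- exact: gam_unit_simple etE.
- exact: rhoM rhoE.
- exact: rho_twist mE DE epE cardG rho rhoE.
- exact: sum_rho etE epE cardG rho rhoE.
- exact: rho_sum_inj rhoE.
- exact: rho_aut mE etE rho rhoE.
- exact: aut_rho mE etE rho rhoE.
- exact: simple_gam u_eq u_bij.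
Qed.

End Fiber.

(** * The spectrum *)

Section Hat.
Variables (F : fieldType) (C : BTC F) (G : C).
Variables (D : Mor G (G ⊗ G)) (ep : Mor G tunit).
Implicit Types X Y Z : C.

Definition counit_at X : Mor (G ⊗ X) X := eqm (tens1x X) ∘ (ep ⊠ idmor X).

Lemma counit_atE X : ⟨counit_at X⟩ = ⟨ep⟩ ▷ X.
Proof. by rewrite /counit_at acomp_eqml. Qed.

Lemma hat_counit X : (G ◁ ⟨ep⟩) • ⟨D⟩ = ⟨idmor G⟩ -> hat D (counit_at X) = idmor (G ⊗ X).
Proof.
move=> e; apply: Arrow_inj; rewrite hatE counit_atE; crwr X e.
by rewrite rwh_id.
Qed.

Lemma hatZ X Y a (s : Mor (G ⊗ X) Y) : hat D (a *: s) = a *: hat D s.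
Proof. by rewrite /hat tensmZr !compZl. Qed.

Lemma hatD X Y (s t : Mor (G ⊗ X) Y) : hat D (s + t) = hat D s + hat D t.
Proof.
by rewrite /hat -{1}[s]scale1r tensm_linr scale1r !compDl.
Qed.

Lemma hat_sum X Y (I : finType) (P : pred I) (s : I -> Mor (G ⊗ X) Y) :
  hat D (\sum_(i | P i) s i) = \sum_(i | P i) hat D (s i).
Proof. by rewrite /hat tensm_sumr !comp_suml. Qed.

End Hat.

Section Z2.
Variables (F : fieldType) (C : BTC F).
Implicit Types X Y W : C.

Lemma Z2P X : Z2 C X <-> forall Y, br X Y = bri Y X.
Proof.
split=> h Y; last by rewrite h brK.
exact: br_inv_uniq (h Y).
Qed.

(** Covers direct sums and retracts at once: by naturality both crossings agree on each morphism
    that factors through a transparent object. *)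
Lemma Z2_factor X (n : nat) (Y : 'I_n -> C) (u : forall i, Mor (Y i) X)
    (v : forall i, Mor X (Y i)) (P : pred 'I_n) :
  (forall i, P i -> Z2 C (Y i)) -> \sum_(i | P i) (u i ∘ v i) = idmor X -> Z2 C X.
Proof.
move=> hY uv; apply/Z2P => W.
rewrite -[LHS]comp_idr -[RHS]comp_idr -tensm_id -uv tensm_suml !comp_sumr.
apply: eq_bigr => i /hY /Z2P hi.
rewrite -(comp_idl (idmor W)) tensm_comp !Defs.compA br_nat bri_nat hi.
by [].
Qed.

Lemma Z2_sub X Y (u : Mor Y X) (v : Mor X Y) : v ∘ u = idmor Y -> Z2 C X -> Z2 C Y.
Proof.
move=> vu hX; apply: (@Z2_factor Y 1 (fun=> X) (fun=> v) (fun=> u) predT) => //.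
by rewrite big_ord1.
Qed.

End Z2.

Section Galois.
Variables (F : closedFieldType) (C : BTC F) (S : set C) (gT : finGroupType).
Variables (A : frob_data C) (rho : gT -> Mor (Gam A) (Gam A)).
Hypotheses (hS : tensor_subcat S) (sym : symmetric_on S).
Hypothesis cardG : #|gT|%:R != 0 :> F.
Hypothesis charF : [pchar F] =i pred0.
Hypothesis ra : regular_algebra S rho.
Implicit Types X Y Z : C.

Local Notation G := (Gam A).
Local Notation D := (acomul A).
Local Notation m := (amul A).
Local Notation ep := (acnt A).
Local Notation et := (aunt A).
Local Notation J := (fun X : C => br G X).
Local Notation K := (fun X : C => bri X G).
Local Notation hat := (hat D).
Local Notation grd k s := (graded D J K (rho k) s).
Local Notation S0 := (S `&` Z2 C).
Local Notation comp k X := (homcomp D ep J K m (rho k) X).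

Let hJ : half_braiding D ep J := half_braiding_br D ep.
Let hK : half_braiding D ep K.
Proof. exact/half_braiding_bri/(sym (ra_in ra) (ra_in ra)). Qed.

Let coassoc := ra_coassoc ra.
Let ss := btc_semisimple C.

Lemma homcomp_graded k X : grd k (comp k X).
Proof.
rewrite /graded (homcomp_K coassoc (ra_cocomm ra) J hK (ra_frob_r ra)).
by rewrite (homcomp_J coassoc (ra_cocomm ra) K hJ X (ra_rho_twist ra k)).
Qed.

Lemma sum_homcomp X : \sum_k comp k X = #|gT|%:R *: counit_at ep X.
Proof.
have -> : counit_at ep X = homcomp D ep J K m (et ∘ ep) X.
  apply: Arrow_inj; rewrite counit_atE.
  by rewrite (homcomp_counit (ra_counitl ra) hJ hK (ra_unitl ra)).
have -> : #|gT|%:R *: homcomp D ep J K m (et ∘ ep) X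
    = homcomp D ep J K m (\sum_k rho k) X.
  rewrite (ra_sum_rho ra) /homcomp tensmZl !(compZr, tensmZr, compZl).
  by [].
by rewrite /homcomp tensm_suml !(comp_sumr, tensm_sumr, comp_suml).
Qed.

Definition grades (k : gT) : Prop :=
  exists (X Y : C) (s : Mor (G ⊗ X) Y), s <> 0 /\ grd k s.

(** Γ is its own dual with evaluation ε ∘ m; contraction turns a morphism Y → Γ ⊗ X of $\mathcal C$
    into a morphism from Y to X in $\mathcal C\rtimes_0\mathcal S$. *)
Definition contract X : Mor (G ⊗ (G ⊗ X)) X :=
  eqm (tens1x X) ∘ ((ep ∘ m) ⊠ idmor X) ∘ asc G G X.

Lemma contractE X : ⟨contract X⟩ = (⟨ep⟩ • ⟨m⟩) ▷ X.
Proof. by rewrite /contract acomp_eqmr acomp_eqml rwhE acompE. Qed.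

Lemma contract_comul X : (G ◁ ⟨contract X⟩) • (⟨D⟩ ▷ G ▷ X) = ⟨m⟩ ▷ X.
Proof. by rewrite contractE; layers; crwr X (ra_frob_l ra). Qed.

(** Projected to a simple summand Y of its target, a nonzero graded morphism is split in $\mathcal
    C$ by some h; composing with the contraction of h keeps the grade and restores h at the unit.
    The trace is then that of the identity of Y. *)
Lemma grades_unital k : grades k -> exists (Y : C) (s : Mor (G ⊗ Y) Y),
  [/\ simple_ob Y, grd k s & ⟨s⟩ • (⟨et⟩ ▷ Y) = ⟨idmor Y⟩].
Proof.
move=> [X [Y0 [s0 [/(component_neq0 ss) [Y [b [sY bs0]]] gs0]]]].
have [h fh] := split_epi_simple ss sY bs0.
exists Y, (b ∘ s0 ∘ hat (contract X ∘ (idmor G ⊠ h))); split=> //.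
  exact/(graded_compr coassoc)/(graded_compl hJ hK).
rewrite acompE hatE (acompE (contract X)) lwhE; layers.
crw (wh_exch D h); crw (wh_exch et h).
crw (contract_comul X); crwr X (ra_unitl ra); rewrite rwh_id acomp_idl //.
by rewrite -!acompE fh.
Qed.

Lemma ptr_unital Y (s : Mor (G ⊗ Y) Y) : simple_ob Y ->
  ⟨s⟩ • (⟨et⟩ ▷ Y) = ⟨idmor Y⟩ -> scal (ptr s ∘ et) != 0.
Proof.
move=> sY se; apply: scal_neq0.
suff -> : ptr s ∘ et = evbar Y ∘ coev Y by apply: qdim_neq0.
apply: Arrow_inj; rewrite acompE ptrE [in RHS]acompE; layers.
crw (wh_exch et (coev Y)); crwr (dual Y) se.
by rewrite rwh_id acomp_idl.
Qed.

Lemma gradesM k l : grades k -> grades l -> grades (k * l)%g.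
Proof.
move=> [X [X' [s [s0 gs]]]] /grades_unital [Y [t [sY gt te]]].
exists (X ⊗ Y), (X' ⊗ Y), (gtens D J s t); split; last first.
  by rewrite -(ra_rhoM ra); exact: (graded_gtens coassoc (ra_cocomm ra) hJ hK gs gt).
apply: (gtens_neq0 (ra_counitl ra) hJ s0 _ (ptr_unital sY te)).
exact: (ptr_counit (ra_counit_simple ra) (ra_counit_unit ra)).
Qed.

Lemma grades_div k l : grades k -> grades l -> grades (k * l^-1)%g.
Proof.
(* In a finite group the inverse is a power, so closure under products suffices. *)
move=> gk gl; rewrite invg_expg; elim: _.-1 => [|n IHn].
  by rewrite expg0 mulg1.
by rewrite expgSr mulgA; apply: gradesM.
Qed.

(** Otherwise all components of the inverse monodromy with 1 vanish, hence so does their sum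
    $|G|\,\varepsilon$, contradicting ε ∘ η = id. *)
Lemma grades_exists : exists k, grades k.
Proof.
apply: contrapT => h; apply: (btc_one C).1.
have e : #|gT|%:R *: counit_at ep tunit = 0.
  rewrite -sum_homcomp big1 // => k _; apply: contrapT => n0; apply: h; exists k.
  by exists tunit, tunit, (comp k tunit); split=> //; apply: homcomp_graded.
move/eqP: e; rewrite scaler_eq0 (negPf cardG) => /eqP e.
apply: Arrow_inj; rewrite -(ra_counit_unit ra) acompE.
have -> : ⟨ep⟩ = ⟨0 : Mor (G ⊗ tunit) tunit⟩ by rewrite -e counit_atE rwh_unit.
by rewrite acomp0l.
Qed.

(** $|H|$ times the projection of Γ onto its H-invariants. *)
Definition sum_grades : Mor G G := \sum_(k | `[< grades k >]) rho k.

Lemma sum_grades_rho k : grades k -> sum_grades ∘ rho k = sum_grades.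
Proof.
move=> gk; rewrite /sum_grades comp_suml.
rewrite [RHS](reindex_inj (mulIg k)) /=; apply: eq_big => [l|l _]; last exact: (ra_rhoM ra).
apply/idP/idP => /asboolP h; apply/asboolP; first exact: gradesM.
by rewrite -(mulgK k l); apply: grades_div.
Qed.

(** Insert the identity as the sum of the components: on the k-th one the two crossings differ by
    [rho k], which [sum_grades] absorbs if k lies in H; for other k the component is 0. *)
Lemma sum_grades_transparent X :
  (idmor X ⊠ sum_grades) ∘ bri X G = (idmor X ⊠ sum_grades) ∘ br G X.
Proof.
pose c := #|gT|%:R^-1 *: \sum_k comp k X.
have hc : hat c = idmor (G ⊗ X).
  rewrite /c sum_homcomp scalerA mulVf // scale1r.
  exact/hat_counit/(ra_counitr ra).
rewrite -[LHS]comp_idr -[RHS]comp_idr -hc /c hatZ hat_sum !compZr; congr (_ *: _).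
rewrite !comp_sumr; apply: eq_bigr => k _.
have gk : bri X G ∘ hat (comp k X) = (idmor X ⊠ rho k) ∘ br G X ∘ hat (comp k X).
  apply: Arrow_inj; rewrite acompE (homcomp_graded k X).
  by rewrite [RHS](acompE (_ ∘ _)) (acompE _ (br G X)) -acompA.
have [hk|nk] := pselect (grades k); last first.
  have -> : comp k X = 0.
    apply: contrapT => n0; apply: nk; exists X, X, (comp k X).
    by split=> //; apply: homcomp_graded.
  by rewrite -(scale0r (0 : Mor (G ⊗ X) X)) hatZ !compZr !scale0r.
by rewrite -Defs.compA gk !Defs.compA -tensm_comp comp_idl sum_grades_rho.
Qed.

Lemma sum_grades_image : exists (Y : C) (u : Mor Y G) (v : Mor G Y) (a : F),
  [/\ S0 Y, a != 0 & u ∘ v = a *: sum_grades].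
Proof.
pose a : F := #|[pred k | `[< grades k >]]|%:R^-1.
have n0 : #|[pred k | `[< grades k >]]|%:R != 0 :> F.
  have /pcharf0P -> := charF; rewrite -lt0n; apply/card_gt0P.
  by have [k gk] := grades_exists; exists k; apply/asboolP.
have ee : (a *: sum_grades) ∘ (a *: sum_grades) = a *: sum_grades.
  rewrite compZl compZr; congr (_ *: _); rewrite {2}/sum_grades comp_sumr.
  rewrite (eq_bigr (fun=> sum_grades)) => [|k /asboolP]; last exact: sum_grades_rho.
  by rewrite sumr_const -scaler_nat scalerA mulVf // scale1r.
have [Y [u [v [vu uv]]]] := ss_split ss ee.
exists Y, u, v, a; split=> //; last by rewrite invr_neq0.
split; first exact: sub_sub vu (ra_in ra).
apply/Z2P => X.
have vE : v = v ∘ (a *: sum_grades) by rewrite -uv Defs.compA vu comp_idl.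
have tr : (idmor X ⊠ v) ∘ bri X G = (idmor X ⊠ v) ∘ br G X.
  rewrite vE -[idmor X]comp_idl !tensm_comp -!Defs.compA tensmZr !compZl.
  by rewrite sum_grades_transparent.
rewrite -[LHS]comp_idr -[RHS]comp_idr -tensm_id -vu -[idmor X]comp_idl !tensm_comp.
by rewrite !Defs.compA br_nat bri_nat tr.
Qed.

(** Sum the projections onto the simple summands in [S0]. A simple summand receiving a nonzero
    morphism from an object of [S0] is a retract of it, hence already counted; so the complement
    receives none. *)
Lemma isotypic_exists : exists q, isotypic_idempotent S0 (q : Mor G G).
Proof.
have [n [P [sP [u [v [vu vu0 uv]]]]]] := ss_decomp ss G.
pose e := \sum_(i | `[< S0 (P i) >]) (u i ∘ v i).
have ve i : v i ∘ e = if `[< S0 (P i) >] then v i else 0.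
  rewrite /e comp_sumr; case: ifP => [h|h].
    rewrite (bigD1 i) //= big1 => [|j /andP[_ ji]].
      by rewrite Defs.compA vu comp_idl addr0.
    by rewrite Defs.compA vu0 // comp0m.
  rewrite big1 // => j hj; rewrite Defs.compA vu0 ?comp0m //.
  by apply: contraFneq h => <-.
have ee : e ∘ e = e.
  rewrite {1}/e comp_suml; apply: eq_bigr => i hi.
  by rewrite -Defs.compA ve hi.
have ee' : (idmor G - e) ∘ (idmor G - e) = idmor G - e.
  by rewrite compBl comp_idl compBr comp_idr ee subrr subr0.
have [X0 [i [r [ri ir]]]] := ss_split ss ee.
have [Z [j [t [tj jt]]]] := ss_split ss ee'.
exists e, X0, Z, i, r, j, t; split=> //; first by rewrite ir jt addrC subrK.
split.
  split; first exact: sub_sub ri (ra_in ra).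
  apply: (@Z2_factor _ _ X0 n P (fun k => r ∘ u k) (fun k => v k ∘ i)
    (fun k => `[< S0 (P k) >])) => [k /asboolP[]//|].
  under eq_bigr do rewrite Defs.compA -(Defs.compA r).
  rewrite -comp_suml -comp_sumr -/e -ir.
  by rewrite !Defs.compA ri comp_idl ri.
move=> Y s [SY ZY]; apply: contrapT => s0.
have js0 : j ∘ s <> 0.
  by move=> js; apply: s0; rewrite -[s]comp_idl -tj -Defs.compA js compm0.
have [k ks] : exists k, v k ∘ (j ∘ s) <> 0.
  apply: contrapT => h; apply: js0.
  rewrite -[j ∘ s]comp_idl -uv comp_suml big1 // => k _.
  rewrite -Defs.compA; suff -> : v k ∘ (j ∘ s) = 0 by rewrite compm0.
  by apply: contrapT => hk; apply: h; exists k.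
have [h hk] := split_epi_simple ss (sP k) ks.
have Sk : S0 (P k).
  by split; [apply: sub_sub hk SY|apply: Z2_sub hk ZY].
apply: ks; rewrite Defs.compA.
have -> : v k ∘ j = v k ∘ (j ∘ t) ∘ j by rewrite -!Defs.compA tj comp_idr.
by rewrite jt compBr comp_idr ve asboolT // subrr !comp0m.
Qed.

(** Fixing the H-invariants means that [rho k] leaves the sum over H unchanged; independence of the
    translations then gives kH = H. *)
Lemma normal_subgroup_grades k : normal_subgroup_of A S0 (rho k) -> grades k.
Proof.
move=> [_ [q [X0 [Z [i [r [j [t [ri tj one -> [SX SZ]]]]]]]] kq]].
have [Y [u [v [a [SY a0 uv]]]]] := sum_grades_image.
have qe : i ∘ r ∘ (u ∘ v) = u ∘ v.
  rewrite -[RHS]comp_idl -one compDl -(Defs.compA j) (Defs.compA t) (SZ _ (t ∘ u)) //.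
  by rewrite comp0m compm0 addr0.
have ke : rho k ∘ (u ∘ v) = u ∘ v by rewrite -qe Defs.compA kq.
move: ke; rewrite uv compZr => /(scalerI a0).
rewrite /sum_grades comp_sumr; under eq_bigr do rewrite (ra_rhoM ra).
rewrite (reindex_inj (mulgI k^-1)%g) /=; under eq_bigr do rewrite mulKVg.
move/(ra_rho_sum_inj ra) => h; have [l gl] := grades_exists.
have := h (k * l)%g; rewrite mulKg asboolT // => /esym/asboolP gkl.
by rewrite -(mulgK l k); apply: grades_div.
Qed.

Lemma hcompE X Y Z (t : Mor (G ⊗ Y) Z) (s : Mor (G ⊗ X) Y) : t ∘^ s = t ∘ hat s.
Proof. by rewrite /hcomp /hat !Defs.compA. Qed.

Lemma hcompA W X Y Z (u : Mor (G ⊗ Y) Z) (t : Mor (G ⊗ X) Y) (s : Mor (G ⊗ W) X) :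
  u ∘^ (t ∘^ s) = (u ∘^ t) ∘^ s.
Proof. by rewrite !hcompE (hat_comp coassoc) Defs.compA. Qed.

Lemma hcomp_linl X Y Z (s : Mor (G ⊗ X) Y) : linear (fun t : Mor (G ⊗ Y) Z => t ∘^ s).
Proof. by move=> a t t'; rewrite !hcompE comp_linl. Qed.

Lemma hcomp_linr X Y Z (t : Mor (G ⊗ Y) Z) : linear (fun s : Mor (G ⊗ X) Y => t ∘^ s).
Proof. by move=> a s s'; rewrite !hcompE hatD hatZ comp_linr. Qed.

(** Averaging over Γ turns a generalized inverse of [hat s] in C into one of s. *)
Lemma regular_hcomp X (s : Mor (G ⊗ X) X) :
  exists t : Mor (G ⊗ X) X, s ∘^ t ∘^ s = s.
Proof.
have [h hs] := regular_mor ss (hat s).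
pose w := contract X ∘ hat h.
have hsE : ⟨hat s⟩ • ⟨h⟩ • ⟨hat s⟩ = ⟨hat s⟩ by rewrite acompA -!acompE hs.
have sm : ⟨contract X⟩ • (G ◁ ⟨hat s⟩) = ⟨s⟩ • (⟨m⟩ ▷ X).
  rewrite contractE hatE; layers; crw - (wh_exch m s); crw - (wh_exch ep s).
  by crwr X (ra_frob_r ra).
(* The constant compensates m ∘ Δ = $|G|$ id, which appears when Γ is contracted. *)
exists (#|gT|%:R^-1 *: w); rewrite -hcompA !hcompE compZl hatZ compZr.
suff -> : s ∘ hat (w ∘ hat s) = #|gT|%:R *: s by rewrite scalerA mulVf // scale1r.
apply: Arrow_inj; rewrite acompE hatE (acompE w) (acompE (contract X)) (hatE D h).
layers; crwl G (hat_coact coassoc s); crwr X (esym coassoc).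
crw (wh_exch D (hat s)); crw (wh_exch D h); crw (contract_comul X).
crw - sm; crwl G hsE; crw sm.
rewrite -rwh_comp // -acompE (ra_special ra) -/(ascale _ ⟨idmor G⟩) rwh_scale acompZr.
by rewrite rwh_id acomp_idr.
Qed.



Lemma spec_grades k : grades k -> Spec A (rho k).
Proof.
move=> /grades_unital [Y [s [sY gs se]]]; split; first exact: (ra_rho_aut ra).
(* On idempotents this form is [gdim], so the idempotent found below has nonzero dimension. *)
pose tau (x : Mor (G ⊗ Y) Y) := scal (ptr x ∘ et).
have tauZ a x : tau (a *: x) = a * tau x.
  by rewrite /tau /ptr tensmZl !(compZl, compZr) scalZ.
have tauD x y : tau (x + y) = tau x + tau y.
  rewrite /tau /ptr -{1}[x]scale1r tensm_linl scale1r !(compDl, compDr).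
  by rewrite scalD.
have [p [z [pp ps tp pz]]] := simple_idempotent (mul := fun x y => x ∘^ y)
  (@hcompA Y Y Y Y) (@hcomp_linl Y Y Y) (@hcomp_linr Y Y Y) (@regular_hcomp Y)
  tauD tauZ (ptr_unital sY se).
pose P := GObj pp.
have p0 : p <> 0 by move=> p0; case/eqP: tp; rewrite p0 -(scale0r 0) tauZ mul0r.
have sP : gsimple P.
  by split=> // t tP; have [a ta] := ps t; exists a; rewrite -ta -hcompA.
(* Lying in the right ideal of s is what makes p inherit its grade. *)
have gp : graded D J K (rho k) p by rewrite pz hcompE; apply: graded_compr.
have gradeP : grade P = rho k.
  rewrite -[LHS]comp_idl.
  apply: (grade_eq (ra_counit_simple ra) (ra_counit_unit ra) (ra_counitr ra)).
    rewrite rwh_id acomp_idl /=; last by side.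
    have nat : ⟨bri G Y⟩ • (Y ◁ ⟨rho k⟩) = (⟨rho k⟩ ▷ Y) • ⟨bri G Y⟩.
      exact: arrow_bri_nat.
    rewrite gp; crw nat; crw (arrow_brK G Y).
    by rewrite acomp_idl //; side.
  by rewrite gdimE.
exists P; split=> //; exists 1%N, (fun=> P); split=> //.
exists (fun=> p), (fun=> p); split=> //.
- by move=> i; rewrite /ghom /= !pp.
- by move=> i j; rewrite !ord1.
- by rewrite big_ord1.
Qed.

(** Trivial monodromy of $\Gamma_0$ gives q ∘ g = q only. As no nonzero morphism leads from
    $\Gamma_0$ to its complement, g preserves $\Gamma_0$, and g ∘ q = q follows. *)
Lemma isotypic_grade (g : Mor G G) q :
  Spec A g -> isotypic_idempotent S0 q -> g ∘ q = q.
Proof.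
move=> [[gm gu] [P [P0 [n [Q [hQ [u [v [_ _ _ uv]]]]]]]]].
have [i _] : exists i : 'I_n, True.
  case: n Q hQ u v uv => [|n] Q hQ u v uv; last by exists ord0.
  by case: P0; rewrite -uv big_ord0.
have [[p0 _] gQ] := hQ i; move: (Q i) p0 gQ => {Q hQ u v uv} R p0 gR.
move=> [X0 [Z [a [r [j [t [ra' tj one -> [SX SZ]]]]]]]].
(* Since the inverse of 0 is 0, dimension 0 would force g = 0, which cannot fix η. *)
have d0 : gdim R != 0.
  apply/eqP => d0; apply: (btc_one C).1.
  rewrite -(ra_counit_unit ra) -gu -gR /grade d0 invr0 scale0r comp0m compm0 //.
have qg : a ∘ r ∘ g = a ∘ r.
  rewrite -gR.
  apply: (grade_eq (ra_counit_simple ra) (ra_counit_unit ra) (ra_counitr ra)) => //.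
  set X := gcar R.
  have mono : ((a ∘ r) ⊠ idmor X) ∘ bri G X ∘ bri X G = (a ∘ r) ⊠ idmor X.
    rewrite -[idmor X]comp_idl tensm_comp -(Defs.compA (a ⊠ _)) -bri_nat.
    rewrite -!Defs.compA -bri_nat (Defs.compA (bri X0 X)).
    by have [_ /Z2P/(_ X) <-] := SX; rewrite brK comp_idl.
  by rewrite -rwhE 2!acompA -!acompE mono.
have tg : t ∘ g ∘ a = 0 by apply: SZ.
have ga : g ∘ a = a.
  rewrite -[g ∘ a]comp_idl -one compDl -(Defs.compA j) Defs.compA (Defs.compA t).
  rewrite tg compm0 addr0 qg.
  by rewrite -Defs.compA ra' comp_idr.
by rewrite Defs.compA ga.
Qed.

Lemma Spec_normal_subgroup : Spec A = normal_subgroup_of A S0.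
Proof.
apply/seteqP; split=> g.
  move=> gS; split; first by case: gS.
  by have [q hq] := isotypic_exists; exists q => //; apply: isotypic_grade hq.
move=> gN; have [ga _] := gN; have [k gk] := ra_aut_rho ra ga.
by rewrite gk in gN *; apply/spec_grades/normal_subgroup_grades.
Qed.

(** * The case of full spectrum *)

Lemma aut_fixes_trivial g (X : C) (n : nat) (s : Mor X G) : AutAlg A g ->
  dirsum (fun _ : 'I_n => tunit) X -> g ∘ s = s.
Proof.
move=> [_ gu] [u [v [_ _ uv]]].
rewrite -[s]comp_idr -uv !comp_sumr; apply: eq_bigr => i _.
have [a e] := ra_unit_simple ra (s ∘ u i).
by rewrite (Defs.compA s) e Defs.compA compZr gu.
Qed.

(** A simple summand of X has a nonzero morphism s to Γ with image in $\Gamma_0$, so all of G fixes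
    s. Averaging over G makes s factor through 1, and Schur's lemma identifies the summand with
    1. *)
Lemma trivial_of_full_normal (X : C) :
  (forall k, normal_subgroup_of A S0 (rho k)) -> S0 X ->
  exists n : nat, dirsum (fun _ : 'I_n => tunit) X.
Proof.
move=> hN [SX ZX]; have [n [P [sP [u [v [vu vu0 uv]]]]]] := ss_decomp ss X.
exists n.
have isoP i : exists ab : Mor (P i) tunit * Mor tunit (P i),
    ab.2 ∘ ab.1 = idmor (P i) /\ ab.1 ∘ ab.2 = idmor tunit.
  have S0P : S0 (P i) by split; [apply: sub_sub (vu i) SX|apply: Z2_sub (vu i) ZX].
  have [s s0] := ra_simple ra S0P.1 (sP i).1.
  have fix_s k : rho k ∘ s = s.
    have [_ [q [X0 [Z [a [r [j [t [_ _ one qE [_ SZ]]]]]]]] kq]] := hN k.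
    have qs : q ∘ s = s.
      rewrite -[RHS]comp_idl -one compDl -(Defs.compA j) (SZ _ (t ∘ s)) //.
      by rewrite compm0 addr0 qE.
    by rewrite -qs Defs.compA kq.
  have es : s = et ∘ (ep ∘ s).
    apply: (scalerI cardG); rewrite Defs.compA -compZl -(ra_sum_rho ra) comp_suml.
    by rewrite (eq_bigr (fun=> s)) // sumr_const scaler_nat.
  have es0 : ep ∘ s <> 0 by move=> h; apply: s0; rewrite es h compm0.
  have [b [h1 h2]] := simple_iso ss (sP i) (btc_one C) es0.
  by exists (ep ∘ s, b).
pose ab i := projT1 (cid (isoP i)).
have abP i : (ab i).2 ∘ (ab i).1 = idmor (P i) /\ (ab i).1 ∘ (ab i).2 = idmor tunit.
  exact: projT2 (cid (isoP i)).
exists (fun i => u i ∘ (ab i).2), (fun i => (ab i).1 ∘ v i); split.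
- move=> i; rewrite Defs.compA -(Defs.compA _ (v i)) vu comp_idr.
  by case: (abP i).
- move=> i j ij; rewrite Defs.compA -(Defs.compA _ (v j)) vu0 //.
  by rewrite compm0 comp0m.
rewrite -uv; apply: eq_bigr => i _.
by rewrite Defs.compA -(Defs.compA (u i)) (abP i).1 comp_idr.
Qed.

(** For the converse, $\Gamma_0$ is a multiple of 1, and automorphisms fix every morphism from 1 to
    Γ because they fix η. *)
Lemma full_Spec : Spec A = AutAlg A <->
  forall X : C, S0 X -> exists n : nat, dirsum (fun _ : 'I_n => tunit) X.
Proof.
rewrite Spec_normal_subgroup; split=> [NA X hX|triv].
  by apply: trivial_of_full_normal hX => k; rewrite NA; apply: (ra_rho_aut ra).
apply/seteqP; split=> g; first by case.
move=> ga; split=> //; have [q hq] := isotypic_exists; exists q => //.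
have [X0 [Z [a [r [j [t [_ _ _ -> [SX _]]]]]]]] := hq.
have [n dn] := triv _ SX.
by rewrite Defs.compA (aut_fixes_trivial a ga dn).
Qed.

End Galois.

Theorem theorem3p26 (F : closedFieldType) (charF : [pchar F] =i pred0)
    (C : BTC F) (S : set C) (hS : finite_admissible_STC S)
    (gT : finGroupType) (E : rep_functor C gT) (hE : sym_tensor_equiv S E)
    (A : frob_data C) (hA : regular_frobenius S E A) :
  let S0 : set C := S `&` Z2 C in
  Spec A = normal_subgroup_of A S0 /\
  (Spec A = AutAlg A <->
   forall X : C, S0 X -> exists n : nat, dirsum (fun _ : 'I_n => tunit) X).
Proof.
have cardG : #|gT|%:R != 0 :> F.
  have /pcharf0P -> := charF; rewrite -lt0n; apply/card_gt0P.
  by exists 1%g.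
have [hT hsym _ _] := hS.
have [rho ra] := regular_frobenius_algebra hT hE hA cardG.
by split; [apply: Spec_normal_subgroup ra|apply: full_Spec ra].
Qed.
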